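(* There do not exist $K \in \mathbb{R}$ and $\beta > 0$ such that the measured geodesic space $(\mathcal{G}_0, d^{L^2}, \mathbb{Q}^\beta_0)$ has generalized $\mathrm{Ric} \geq K$. Here $\mathcal{G}_0$ is the set of right continuous nondecreasing functions $g:[0,1]\to[0,1]$ regarded as a subset of $L^2([0,1])$, $d^{L^2}$ is the metric induced by the $L^2$ norm, and $\mathbb{Q}^\beta_0$ is the entropic measure on $\mathcal{G}_0$ with parameter $\beta$.
   Context: **Wasserstein distance.** For a compact metric space $(X,d)$, $\mathcal{P}(X)$ denotes the set of Borel probability measures on $X$. For $\mu,\nu\in\mathcal{P}(X)$, let $\Pi(\mu,\nu)$ be the set of $\pi\in\mathcal{P}(X\times X)$ with first marginal $\mu$ and second marginal $\nu$. The 2-Wasserstein distance is given by $$d^W(\mu,\nu)^2 := \inf_{\pi\in\Pi(\mu,\nu)}\int_{X\times X} d(x,y)^2\, d\pi(x,y).$$ **Geodesics.** A geodesic from $x_0$ to $x_1$ in a metric space is a continuous curve $\gamma:[0,1]\to X$ with $\gamma(0)=x_0$, $\gamma(1)=x_1$, whose length $\sup_{0=t_0<\dots<t_{N+1}=1}\sum_{i=0}^N d(\gamma(t_i),\gamma(t_{i+1}))$ equals $d(x_0,x_1)$, parametrized with constant speed, i.e. $d(\gamma(s),\gamma(t))=|s-t|\,d(x_0,x_1)$ for all $s,t\in[0,1]$. A geodesic space is a metric space in which any two points are joined by a geodesic. A measured geodesic space $(X,d,m)$ is a geodesic space $(X,d)$ with a fixed $m\in\mathcal{P}(X)$. **Entropy.**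 For $m\in\mathcal{P}(X)$, $\mathrm{Ent}(\cdot|m):\mathcal{P}(X)\to\mathbb{R}\cup\{+\infty\}$ is defined by $\mathrm{Ent}(\mu|m)=\int_X\rho\log\rho\, dm$ if $\mu=\rho m\ll m$ (with $0\log 0=0$), and $\mathrm{Ent}(\mu|m)=+\infty$ otherwise. **Generalized Ricci bound.** A measured geodesic space $(X,d,m)$ has generalized $\mathrm{Ric}\geq K$ if $\mathrm{Ent}(\cdot|m)$ is weakly a.c. $K$-displacement convex, that is: for any $\mu_0,\mu_1\in\mathcal{P}(X)$ with $\mu_0,\mu_1\ll m$ there exists a geodesic $(\mu_t)_{t\in[0,1]}$ in $(\mathcal{P}(X),d^W)$ from $\mu_0$ to $\mu_1$ such that for all $t\in[0,1]$ $$\mathrm{Ent}(\mu_t|m)\leq t\,\mathrm{Ent}(\mu_1|m)+(1-t)\,\mathrm{Ent}(\mu_0|m)-\tfrac{K}{2}t(1-t)\,d^W(\mu_0,\mu_1)^2.$$ **The space $\mathcal{G}_0$.** $\mathcal{G}_0\subset L^2([0,1])$ is the set of (classes of) right continuous nondecreasing functions $g:[0,1]\to[0,1]$; as usual in $L^2$, functions equal almost everywhere are identified, and for $s\in[0,1)$, $g(s)$ denotes the value of the right continuous representative. It is a compact convex subset of $L^2([0,1])$, hence $(\mathcal{G}_0,d^{L^2})$ is a geodesic space. **The entropic measure.** For $\beta>0$, $\mathbb{Q}^\beta_0\in\mathcal{P}(\mathcal{G}_0)$ is the unique probability measure (existence and uniqueness due to von Renesse and Sturm) such that for each partition $0=t_0<t_1<\dots<t_N<t_{N+1}=1$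 and each bounded measurable $u:[0,1]^N\to\mathbb{R}$, $$\int_{\mathcal{G}_0}u(g(t_1),\dots,g(t_N))\,d\mathbb{Q}^\beta_0(g)=\frac{\Gamma(\beta)}{\prod_{i=0}^N\Gamma(\beta(t_{i+1}-t_i))}\int_{\Sigma_N}u(x_1,\dots,x_N)\prod_{i=0}^N(x_{i+1}-x_i)^{\beta(t_{i+1}-t_i)-1}\,dx_1\cdots dx_N,$$ where $\Sigma_N=\{(x_1,\dots,x_N)\in[0,1]^N:0=x_0<x_1<\dots<x_N<x_{N+1}=1\}$ and $\Gamma$ is the Gamma function. *)

(* Defs.v *)
From HB Require Import structures.
From mathcomp Require Import all_boot all_order all_algebra.
From mathcomp Require Import all_classical all_reals all_analysis.
From mathcomp Require Import measurable_realfun lra.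

Set Implicit Arguments.
Unset Strict Implicit.
Unset Printing Implicit Defensive.

Import Order.TTheory GRing.Theory Num.Theory.
Import numFieldNormedType.Exports.

Local Open Scope classical_set_scope.
Local Open Scope ring_scope.

Section partitions.
Context {R : realType}.

Definition partition01 N (t : N.-tuple R) : Prop :=
  path <%R 0 (rcons t 1).

(* [knot t i] is t_i for 0 <= i <= N+1, with t_0 = 0 and t_(N+1) = 1 added to
   the interior points t = (t_1, ..., t_N). *)
Definition knot N (t : N.-tuple R) (i : nat) : R := nth 0 (0 :: rcons t 1) i.

End partitions.

Section geodesics.
Context {R : realType} {T : Type}.
Variable d : T -> T -> R.

Definition curve_length (gamma : R -> T) : \bar R :=
  ereal_sup [set l | exists (N : nat) (t : N.-tuple R), partition01 t /\
    l = (\sum_(i < N.+1) d (gamma (knot t i)) (gamma (knot t i.+1)))%:E].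

(* Curves [0,1] -> T are represented by functions on R of which only the values
   on [0,1] matter. *)
Definition continuous_curve (gamma : R -> T) : Prop :=
  forall s, 0 <= s <= 1 -> forall e, 0 < e -> exists2 dlt : R, 0 < dlt &
    forall t, 0 <= t <= 1 -> `|s - t| < dlt -> d (gamma s) (gamma t) < e.

Definition is_geodesic (x0 x1 : T) (gamma : R -> T) : Prop :=
  [/\ continuous_curve gamma,
      gamma 0 = x0 /\ gamma 1 = x1,
      curve_length gamma = (d x0 x1)%:E &
      forall s t, 0 <= s <= 1 -> 0 <= t <= 1 ->
        d (gamma s) (gamma t) = `|s - t| * d x0 x1].

End geodesics.

#[short(type="pmetricType")]
HB.structure Definition PointedMetric (K : numDomainType) :=
  { M of Metric K M & Pointed M }.

Definition borel (T : ptopologicalType) := g_sigma_algebraType (@open T).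

HB.instance Definition _ (T : ptopologicalType) := Measurable.on (borel T).

HB.instance Definition _ (T1 T2 : ptopologicalType) :=
  Pointed.on (T1 * T2)%type.

Section wasserstein.
Local Open Scope charge_scope.
Context {R : realType} (X : pmetricType R).

Definition Prob := probability (borel X) R.

(* X * X carries the Borel sigma-algebra of the product topology, not the product
   sigma-algebra; the two agree when X is separable. *)
Definition coupling (mu nu : Prob) (p : probability (borel (X * X)%type) R)
    : Prop :=
  (forall A : set (borel X), measurable A -> p (fst @^-1` A) = mu A) /\
  (forall A : set (borel X), measurable A -> p (snd @^-1` A) = nu A).

(* The infimum is finite when X is compact, so that [fine] loses nothing. *)
Definition wasserstein (mu nu : Prob) : R :=
  Num.sqrt (fine (ereal_inf
    [set c | exists2 p, coupling mu nu p &
       c = (\int[p]_z ((mdist z.1 z.2) ^+ 2)%:E)%E])).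

(* The Radon-Nikodym derivative is finite; ln 0 = 0, hence 0 log 0 = 0; the
   negative part of r * ln r is bounded, so the integral is never -oo. *)
Definition Ent (mu m : Prob) : \bar R :=
  if pselect (mu `<< m) then
    (\int[m]_x (let r := fine (('d (charge_of_finite_measure mu) '/d m) x)
                in r * ln r)%:E)%E
  else +oo%E.

Definition generalized_Ric_ge (m : Prob) (K : R) : Prop :=
  forall mu0 mu1 : Prob, mu0 `<< m -> mu1 `<< m ->
  exists2 mu_ : R -> Prob, is_geodesic wasserstein mu0 mu1 mu_ &
    forall t : R, 0 <= t <= 1 ->
      (Ent (mu_ t) m <= t%:E * Ent mu1 m + (1 - t)%:E * Ent mu0 m
         - (K / 2 * t * (1 - t) * wasserstein mu0 mu1 ^+ 2)%:E)%E.

End wasserstein.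

Section lebesgue_tuple.
Context {R : realType}.

Section step.
Variables (n : nat).
Variable mu : {sigma_finite_measure set (n.-tuple (measurableTypeR R)) -> \bar R}.

Let cons_pair (z : measurableTypeR R * n.-tuple (measurableTypeR R)) :
  n.+1.-tuple (measurableTypeR R) := [tuple of z.1 :: z.2].

Let measurable_cons_pair : measurable_fun [set: _] cons_pair.
Proof. exact: measurable_cons measurable_fst measurable_snd. Qed.

Definition lebesgue_cons := pushforward (lebesgue_measure \x mu)%E cons_pair.

HB.instance Definition _ := Measure.copy lebesgue_cons
  (measure_function_pushforward__canonical__measure_function_Measure
     (lebesgue_measure \x mu)%E measurable_cons_pair).

Let lebesgue_cons_sigma_finite : sigma_finite setT lebesgue_cons.
Proof.
have [F FT Foo] : sigma_finite setT (lebesgue_measure \x mu)%E.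
  have /sigma_finiteP[F [TF ndF Foo]] := sigma_finiteT (@lebesgue_measure R).
  have /sigma_finiteP[G [TG ndG Goo]] := sigma_finiteT mu.
  exists (fun n => F n `*` G n).
    rewrite -setXTT TF TG predeqE => -[x y]; split.
      move=> [/= [k _ Fkx] [l _ Gly]]; exists (maxn k l) => //; split.
      - by move: x Fkx; exact/subsetPset/ndF/leq_maxl.
      - by move: y Gly; exact/subsetPset/ndG/leq_maxr.
    by move=> [k _ []/= ? ?]; split; exists k.
  move=> k; have [mF Fk] := Foo k; have [mG Gk] := Goo k.
  split; first exact: measurableX.
  by rewrite product_measure1E// lte_mul_pinfty// ge0_fin_numE.
pose unc (x : n.+1.-tuple (measurableTypeR R)) :=
  (thead x, [tuple of behead x]) : measurableTypeR R * n.-tuple (measurableTypeR R).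
have munc : measurable_fun [set: _] unc.
  apply: measurable_fun_pair; first exact: measurable_tnth.
  exact: measurable_behead.
have uncK z : unc (cons_pair z) = z.
  by case: z => a b; congr pair; apply: val_inj.
exists (fun i => unc @^-1` F i).
  by rewrite -preimage_bigcup -FT preimage_setT.
move=> i; have [mF Fi] := Foo i; split.
  by rewrite -[X in measurable X]setTI; exact: munc.
rewrite /lebesgue_cons /pushforward (_ : _ @^-1` _ = F i)//.
by apply/seteqP; split => z /=; rewrite uncK.
Qed.

HB.instance Definition _ := Measure_isSigmaFinite.Build _ _ _ lebesgue_cons
  lebesgue_cons_sigma_finite.

End step.

Fixpoint lebesgue_tuple (n : nat) :
    {sigma_finite_measure set (n.-tuple (measurableTypeR R)) -> \bar R} :=
  match n with
  | 0 => dirac [tuple]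
  | n'.+1 => lebesgue_cons (lebesgue_tuple n')
  end.
End lebesgue_tuple.

(* Only the values on [0,1] of such a g : R -> R are relevant. *)
Definition rc_nondecreasing01 {R : realType} (g : R -> R) : Prop :=
  [/\ forall s, 0 <= s <= 1 -> 0 <= g s <= 1,
      forall s t, 0 <= s -> s <= t -> t <= 1 -> g s <= g t &
      forall s, 0 <= s < 1 -> g x @[x --> s^'+] --> g s].

Record rcfun (R : realType) := Rcfun {
  rcfun_val :> R -> R;
  rcfunP : rc_nondecreasing01 rcfun_val }.

Section G0.
Local Open Scope quotient_scope.
Context {R : realType}.
Implicit Types f g h : rcfun R.

HB.instance Definition _ := gen_eqMixin (rcfun R).
HB.instance Definition _ := gen_choiceMixin (rcfun R).

Definition ae_eq01 f g : bool := `[< ae_eq lebesgue_measure (`[0, 1]%classic : set R) f g >].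

Let ae_eq01_refl : reflexive ae_eq01.
Proof. by move=> f; apply/asboolP; exact: ae_eq_refl. Qed.

Let ae_eq01_sym : symmetric ae_eq01.
Proof. by move=> f g; apply/idP/idP => /asboolP h; apply/asboolP/ae_eq_sym. Qed.

Let ae_eq01_trans : transitive ae_eq01.
Proof.
by move=> f g h /asboolP gf /asboolP fh; apply/asboolP/(ae_eq_trans gf fh).
Qed.

Canonical ae_eq01_equiv :=
  EquivRel ae_eq01 ae_eq01_refl ae_eq01_sym ae_eq01_trans.

Definition G0 : Type := {eq_quot ae_eq01}.
HB.instance Definition _ := Choice.on G0.
HB.instance Definition _ := EqQuotient.on G0.

(* Meaningful for s in [0,1) only, where all representatives agree (see
   [G0_evalE]). *)
Definition G0_eval (g : G0) (s : R) : R := repr g s.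

Let ae_eq01_lt f g s : ae_eq01 f g -> 0 <= s < 1 -> ~ f s < g s.
Proof.
move=> /asboolP[A [mA A0 fgA]] /[dup] s01 /andP[s0 s1] fgs.
have [_ _ /(_ _ s01) cf] := rcfunP f; have [_ _ /(_ _ s01) cg] := rcfunP g.
pose c := (f s + g s) / 2.
have fc : \forall x \near s^'+, f x < c by apply: (cvgr_lt (f s)) => //; by case: (midf_lt fgs).
have gc : \forall x \near s^'+, c < g x by apply: (cvgr_gt (g s)) => //; by case: (midf_lt fgs).
have : \forall x \near s^'+, f x < g x.
  by near=> x; apply: (@lt_trans _ _ c); near: x.
move=> [e /= e0 He].
pose b := Num.min (s + e) 1.
have sb : s < b by rewrite /b lt_min s1 ltrDl e0.
have sbA : (`]s, b[%classic : set R) `<=` A.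
  move=> x /=; rewrite in_itv/= => /andP[sx xb].
  apply: fgA => /= fgx.
  have : f x < g x.
    apply: He => //=; move: xb; rewrite lt_min => /andP[xse _].
    by rewrite ltr0_norm ?subr_lt0// opprB ltrBlDl.
  rewrite fgx ?ltxx// in_itv/= (ltW (le_lt_trans s0 sx))/=.
  by move: xb; rewrite lt_min => /andP[_ /ltW].
have : (lebesgue_measure (`]s, b[%classic : set R) <= 0 :> \bar R)%E.
  by rewrite -A0; apply: le_measure => //; rewrite inE//; exact: measurable_itv.
by rewrite lebesgue_measure_itv/= lte_fin sb -EFinB lee_fin leNgt subr_gt0 sb.
Unshelve. all: by end_near. Qed.

Lemma G0_evalE f s : 0 <= s < 1 -> G0_eval (\pi_G0 f) s = f s.
Proof.
move=> s01; have fg : ae_eq01 (repr (\pi_G0 f)) f.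
  by have /eqmodP := reprK (\pi_G0 f).
rewrite /G0_eval; case: (ltgtP (repr (\pi_G0 f) s) (f s)) => //.
- by move/(ae_eq01_lt fg s01).
- by rewrite ae_eq01_sym in fg; move/(ae_eq01_lt fg s01).
Qed.

Definition L2dist (f g : R -> R) : R :=
  Num.sqrt (\int[lebesgue_measure]_(x in `[0, 1]) (f x - g x) ^+ 2).

Let clamp (x : R) : R := Num.max 0 (Num.min x 1).

Lemma measurable_rcfun f : measurable_fun (`[0, 1]%classic : set R) f.
Proof.
have [f01 fnd _] := rcfunP f.
apply: (eq_measurable_fun (f \o clamp)).
  move=> x; rewrite inE/= in_itv/= => /andP[x0 x1].
  by rewrite /= /clamp (min_idPl x1) (max_idPr x0).
apply: measurable_realfun.nondecreasing_measurable; first exact: measurable_itv.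
move=> x y xy /=; apply: fnd.
- by rewrite le_max lexx.
- rewrite /clamp ge_max !le_max lexx/=; apply/orP; right.
  by rewrite le_min !ge_min xy lexx orbT.
- by rewrite ge_max ler01 ge_min lexx orbT.
Qed.

Let dif f g := (fun x => f x - g x) \_ (`[0, 1] : set R).

Let mdif f g : measurable_fun [set: R] (dif f g).
Proof.
apply/(measurable_restrictT _ (measurable_itv _)).
exact: (measurable_funB (measurable_rcfun f) (measurable_rcfun g)).
Qed.

Let L2distE f g :
  (L2dist f g)%:E = ('N[lebesgue_measure]_2%:E[EFin \o dif f g])%E.
Proof.
rewrite unlock /Lnorm.
pose A : \bar R :=
  (\int[lebesgue_measure]_(x in `[0%R, 1%R]) ((f x - g x) ^+ 2)%:E)%E.
have -> : (\int[lebesgue_measure]_x `|(EFin \o dif f g) x| `^ 2 = A)%E.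
  rewrite /A [RHS]integral_mkcond; apply: eq_integral => x _ /=.
  rewrite /dif !patchE; case: ifP => _.
    by rewrite powR_mulrn// real_normK// num_real.
  by rewrite normr0 powR0.
have A0 : (0 <= A)%E.
  by apply: integral_ge0 => x _; rewrite lee_fin sqr_ge0.
have A1 : (A <= 1)%E.
  have : (A <= \int[lebesgue_measure]_(x in `[0%R, 1%R]) (cst 1 x))%E.
    apply: ge0_le_integral => //.
    - by move=> x _; rewrite lee_fin sqr_ge0.
    - apply/measurable_EFinP; apply: measurable_funX.
      exact: measurable_funB (measurable_rcfun f) (measurable_rcfun g).
    - move=> x; rewrite /= in_itv/= => x01; rewrite lee_fin -real_normK ?num_real//.
      rewrite expr_le1//.
      have [/(_ _ x01) /andP[f0 f1] _ _] := rcfunP f.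
      have [/(_ _ x01) /andP[g0 g1] _ _] := rcfunP g.
      by rewrite ler_norml; lra.
  by rewrite integral_cst//= mul1e lebesgue_measure_itv/= lte_fin ltr01 oppr0 adde0.
rewrite poweR12_sqrt//.
have /fineK <- : A \is a fin_num.
  by rewrite ge0_fin_numE// (le_lt_trans A1)// ltry.
by [].
Qed.

Let L2distxx f : L2dist f f = 0.
Proof.
rewrite /L2dist /Rintegral (eq_integral (cst 0%E)) ?integral0/= ?sqrtr0//.
by move=> x _; rewrite subrr expr0n.
Qed.

Let L2dist_sym f g : L2dist f g = L2dist g f.
Proof.
rewrite /L2dist; congr Num.sqrt; congr fine; apply: eq_integral => x _.
by rewrite -sqrrN opprB.
Qed.

Let L2dist_triangle g f h : L2dist f h <= L2dist f g + L2dist g h.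
Proof.
rewrite -lee_fin EFinD !L2distE.
have -> : dif f h = (dif f g \+ dif g h)%R.
  by apply/funext => x; rewrite /dif /patch/=; case: ifP; rewrite ?addr0// addrA subrK.
by apply: eminkowski; rewrite ?(lee_fin 1 2) ?ler1n//; exact: mdif.
Qed.

Let L2dist_positivity f g : L2dist f g = 0 -> ae_eq lebesgue_measure (`[0, 1]%classic : set R) f g.
Proof.
move=> fg0.
have : ('N[lebesgue_measure]_2%:E[EFin \o dif f g] = 0)%E by rewrite -L2distE fg0.
move/Lnorm_eq0_eq0 => /(_ _ _)[].
- by apply/measurable_EFinP; exact: mdif.
- by rewrite lte_fin.
move=> A [mA A0 HA]; exists A; split => // x /= fgx; apply: HA => /= d0.
apply: fgx => x01; move: (d0 I); rewrite /dif patchE mem_set//.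
by move=> [/eqP]; rewrite subr_eq0 => /eqP.
Qed.

Let rc_cst0 : rc_nondecreasing01 (fun=> 0 : R).
Proof.
split=> [s _|s t _ _ _|s _]; rewrite ?lexx ?ler01//.
exact: cvg_cst.
Qed.

HB.instance Definition _ := isPointed.Build G0 (\pi_G0 (Rcfun rc_cst0)).

Definition G0_dist (f g : G0) : R := L2dist (repr f) (repr g).

Implicit Types (a b c : G0).

Let G0_distxx a : G0_dist a a = 0. Proof. exact: L2distxx. Qed.

Let G0_dist_positivity a b : G0_dist a b = 0 -> a = b.
Proof.
move/L2dist_positivity => ab; rewrite -[a]reprK -[b]reprK.
by apply/eqmodP/asboolP.
Qed.

Let G0_dist_sym a b : G0_dist a b = G0_dist b a. Proof. exact: L2dist_sym. Qed.

Let G0_dist_triangle b a c : G0_dist a c <= G0_dist a b + G0_dist b c.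
Proof. exact: L2dist_triangle. Qed.

HB.instance Definition _ := isMetric.Build R G0
  G0_distxx G0_dist_positivity G0_dist_sym G0_dist_triangle.

End G0.
Arguments G0 : clear implicits.

Section entropic_measure.
Context {R : realType}.

Definition Gamma (a : R) : R :=
  \int[lebesgue_measure]_(x in `]0, +oo[) (x `^ (a - 1) * expR (- x)).

Definition unit_cube N : set (N.-tuple (measurableTypeR R)) :=
  [set x | forall i, 0 <= (tnth x i : R) <= 1].

Definition simplex N : set (N.-tuple (measurableTypeR R)) :=
  [set x | partition01 (x : N.-tuple R)].

(* This characterizes Q^beta_0: for beta > 0 exactly one Borel probability measure
   on G_0 satisfies it (von Renesse and Sturm). *)
Definition is_entropic_measure (beta : R) (Q : Prob (G0 R)) : Prop :=
  forall (N : nat) (t : N.-tuple R), partition01 t ->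
  forall u : N.-tuple (measurableTypeR R) -> R,
  measurable_fun (@unit_cube N) u ->
  (exists M : R, forall x, unit_cube x -> `|u x| <= M) ->
  (\int[Q]_g (u (map_tuple (G0_eval g) t))%:E =
   (Gamma beta / \prod_(i < N.+1) Gamma (beta * (knot t i.+1 - knot t i)))%:E *
   \int[lebesgue_tuple N]_(x in @simplex N)
     (u x * \prod_(i < N.+1)
        (knot x i.+1 - knot x i) `^ (beta * (knot t i.+1 - knot t i) - 1))%:E)%E.

End entropic_measure.

(* Main.v *)
Require Import Defs.
From HB Require Import structures.
From mathcomp Require Import all_boot all_order all_algebra.
From mathcomp Require Import all_classical all_reals all_analysis.
From mathcomp Require Import measurable_realfun lra.

Set Implicit Arguments.
Unset Strict Implicit.
Unset Printing Implicit Defensive.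

Import Order.TTheory GRing.Theory Num.Theory.
Import numFieldNormedType.Exports.

Local Open Scope classical_set_scope.
Local Open Scope ring_scope.

(** The obstruction is visible on a single value [g t] with [t] small. Under the
    entropic measure [g t] has the Beta(beta t, beta (1 - t)) law, with weight
    [x ^ (beta t - 1) * (1 - x) ^ (beta (1 - t) - 1)] on ]0, 1[. As [t] tends to 0
    the weight of ]0, 1/4[ tends to infinity while those of [1/2, 1[ and [1/8, 1[
    stay between positive constants. So almost all of the mass has [g t < 1/4], and
    the events [g t >= 1/2] and [g t >= 1/8] both have a probability of order [t].

    Let [mu0] and [mu1] be the entropic measure conditioned on [g t < 1/4] and on
    [g t >= 1/2]. Their entropies are minus the logarithms of the probabilities
    of these events ([exists_conditioned]). The space is a convex subset of a
    Hilbert space, so a Wasserstein midpoint of [mu0] and [mu1] is carried by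
    midpoints [(x + y) / 2] of points of the two events, hence by the event
    [g t >= 1/8] ([midpoint_null], [sqmdist_midpoint]), and its entropy is at least
    minus the logarithm of the probability of that event ([Ent_ge_supp]). Convexity
    with a curvature bound [K] at time 1/2 then reads
    [P(g t < 1/4) P(g t >= 1/2) <= exp(|K| / 4) P(g t >= 1/8)^2]
    ([Ric_concentration]), the Wasserstein distance being at most 1. After
    cancelling the square of the normalising constant, the left side is unbounded
    as [t] tends to 0 ([beta_int_ge_near0], [beta_int_ge_mid]) and the right side
    is bounded ([beta_int_le_away0]).

    The location of the midpoint measure rests on an elementary gluing. A
    midpoint [nu] comes with near-optimal couplings of [(mu0, nu)] and [(nu, mu1)];
    instead of disintegrating them over [nu], they are glued along a countable
    partition of the space into cells of small diameter ([glue]). The glued pairs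
    share the cell of the middle point rather than the point itself, which only
    costs the mesh of the partition, and near-optimality forces the middle
    point to be close to the midpoint of the end points. *)

(** * Gluing probability measures along a discrete variable *)

Section gluing.
Local Open Scope ereal_scope.
Context {R : realType} d1 d2 (T1 : measurableType d1) (T2 : measurableType d2).

Definition discrete_rv d (T : measurableType d) (i : T -> nat) :=
  forall k, measurable (i @^-1` [set k]).

(** The fibres of a discrete variable form a countable measurable partition. *)
Lemma measure_fibres d (T : measurableType d) (P : {measure set T -> \bar R})
    (i : T -> nat) (A : set T) : discrete_rv i -> measurable A ->
  \sum_(k <oo) P (A `&` i @^-1` [set k]) = P A.
Proof.
move=> mi mA; rewrite -measure_semi_bigcup.
- by rewrite -setI_bigcupr -preimage_bigcup bigcup_imset1 image_id preimage_setT setIT.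
- by move=> k; exact: measurableI.
- apply/trivIsetP => k l _ _ kl; rewrite -subset0 => x [[_ /= ->] [_ /=]].
  by move/eqP : kl.
- apply: bigcup_measurable => k _; exact: measurableI.
Qed.

Variables (p : probability T1 R) (q : probability T2 R).
Variables (i : T1 -> nat) (j : T2 -> nat).
Hypothesis mi : discrete_rv i.
Hypothesis mj : discrete_rv j.
Hypothesis ij : forall k, p (i @^-1` [set k]) = q (j @^-1` [set k]).

Let cond k : probability T2 R := mnormalize (mrestr q (mj k)) q.

Let piece k : {measure set (T1 * T2)%type -> \bar R} :=
  mrestr p (mi k) \x cond k.

Let pieceE k A B : measurable A -> measurable B ->
  piece k (A `*` B) = p (A `&` i @^-1` [set k]) * cond k B.
Proof. by move=> mA mB; rewrite /piece /= product_measure1E. Qed.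

(** On the k-th fibre of [i], sample the first point from [p] and, independently,
    the second one from [q] conditioned on the k-th fibre of [j]. When the fibre
    has measure 0 the conditioning is arbitrary, which is harmless because the
    first factor then vanishes. This replaces a disintegration of [p] and [q]
    over a common marginal by one over a countable discretisation of it. *)
Definition glue : set (T1 * T2) -> \bar R := mseries piece 0.

HB.instance Definition _ := Measure.on glue.

Lemma glue_fst A : measurable A -> glue (fst @^-1` A) = p A.
Proof.
move=> mA; rewrite -(measure_fibres p mi mA) /glue /mseries.
apply: eq_eseriesr => k _; rewrite -setXT pieceE//.
by rewrite probability_setT mule1.
Qed.

Let condE k B : q (j @^-1` [set k]) != 0 ->
  cond k B * q (j @^-1` [set k]) = q (B `&` j @^-1` [set k]).
Proof.
move=> q0; rewrite /cond/= /mnormalize/= /mrestr setTI (negbTE q0)/=.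
have qfin : q (j @^-1` [set k]) \is a fin_num by exact: fin_num_measure.
rewrite ifF; last by apply/negbTE; move: qfin; rewrite fin_numE => /andP[].
rewrite -muleA -{2}(fineK qfin) -EFinM mulVf ?mule1//.
by rewrite fine_eq0.
Qed.

Lemma glue_snd B : measurable B -> glue (snd @^-1` B) = q B.
Proof.
move=> mB; rewrite -(measure_fibres q mj mB) /glue /mseries.
apply: eq_eseriesr => k _; rewrite -setTX pieceE// setTI [X in X * _]ij muleC.
have [q0|] := eqVneq (q (j @^-1` [set k])) 0; last exact: condE.
rewrite q0 mule0; apply/esym/(subset_measure0 _ _ _ q0) => //; exact: measurableI.
Qed.

Lemma glue_diag : {ae glue, forall w, i w.1 = j w.2}.
Proof.
pose N k := i @^-1` [set k] `*` ~` (j @^-1` [set k]).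
have mN k : measurable (N k).
  by apply: measurableX => //; exact: measurableC.
suff : glue.-negligible (\bigcup_k N k).
  apply: negligibleS; by move=> [x y] /= xy; exists (i x) => //; split => //= /esym.
apply: negligible_bigcup => k; exists (N k); split => //.
rewrite [LHS]eseries0// => l _ _.
rewrite pieceE//; last exact: measurableC.
 have [<-|kl] := eqVneq k l; last first.
  rewrite (_ : _ `&` _ = set0) ?measure0 ?mul0e//.
  by rewrite -subset0 => x [/= ->]; apply/eqP.
rewrite setIid ij muleC.
have [->|q0] := eqVneq (q (j @^-1` [set k])) 0; first by rewrite mule0.
by rewrite condE// setICl measure0.
Qed.

Let glue_setT : glue setT = 1.
Proof. by rewrite -(preimage_setT fst) glue_fst// probability_setT. Qed.

HB.instance Definition _ := Measure_isProbability.Build _ _ _ glue glue_setT.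

End gluing.

(** * Midpoints for the Wasserstein distance *)

Lemma exists_law d d' (T : measurableType d) (T' : measurableType d')
    (R : realType) (P : probability T R) (f : T -> T') :
  measurable_fun setT f ->
  exists Q : probability T' R, forall A, Q A = P (f @^-1` A).
Proof.
move=> mf; pose X : {mfun T >-> T'} :=
  HB.pack f (isMeasurableFun.Build _ _ _ _ _ mf).
by exists (distribution P X).
Qed.

Lemma ge0_integral_law d d' (T : measurableType d) (T' : measurableType d')
    (R : realType) (P : {measure set T -> \bar R})
    (Q : {measure set T' -> \bar R}) (f : T -> T') (g : T' -> \bar R) :
  measurable_fun setT f -> (forall A, measurable A -> P (f @^-1` A) = Q A) ->
  measurable_fun setT g -> (forall y, 0 <= g y)%E ->
  (\int[P]_x g (f x) = \int[Q]_y g y)%E.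
Proof.
move=> mf PQ mg g0.
transitivity (\int[pushforward P f]_y g y)%E.
  by rewrite (ge0_integral_pushforward mf)// preimage_setT.
by apply: eq_measure_integral => /= A mA _; exact: PQ.
Qed.

Section borel_maps.
Context {T1 T2 : ptopologicalType}.

Lemma measurable_open (A : set T1) : open A -> measurable (A : set (borel T1)).
Proof. by move=> oA; apply: sub_sigma_algebra. Qed.

Lemma measurable_closed (A : set T1) :
  closed A -> measurable (A : set (borel T1)).
Proof.
move=> cA; rewrite -(setCK A); apply: measurableC; apply: measurable_open.
exact: closed_openC.
Qed.

Lemma continuous_borel (f : T1 -> T2) : continuous f ->
  measurable_fun [set: borel T1] (f : borel T1 -> borel T2).
Proof.
move=> cf; apply: (@measurability _ _ _ (borel T2) _ _ (@open T2)) => //.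
move=> _ [B oB <-]; rewrite setTI; apply: measurable_open.
by apply: open_comp => // x _; exact: cf.
Qed.

End borel_maps.

Section finely_partitioned.
Context {R : realType} (X : pmetricType R).

(** A measurable form of separability: the cells of these discrete variables
    generate the open sets, and couplings can be glued along them. *)
Definition finely_partitioned := forall r : R, 0 < r ->
  exists2 i : borel X -> nat, discrete_rv i &
    forall x y : X, i x = i y -> mdist x y < r.

Hypothesis Xfine : finely_partitioned.

(** An open set is the union of the countably many rectangles of cells, over all
    meshes 1/(n+1), that it contains. Hence the Borel sigma-algebra of the product
    topology is not larger than the product sigma-algebra, and product measures
    yield couplings. *)
Lemma open_measurable_prod (U : set (X * X)) : open U ->
  measurable (U : set (borel X * borel X)%type).
Proof.
move=> oU.
have inv_gt0 n : 0 < n.+1%:R^-1 :> R by rewrite invr_gt0.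
pose i n := sval (cid2 (Xfine (inv_gt0 n))).
have mi n : discrete_rv (i n) by rewrite /i; case: cid2.
have di n x y : i n x = i n y -> mdist x y < n.+1%:R^-1.
  by rewrite /i; case: cid2 => ? ? /= /[apply].
pose C n k : set (borel X) := i n @^-1` [set k].
pose D n kl := if `[< C n kl.1 `*` C n kl.2 `<=` U >] then
  C n kl.1 `*` C n kl.2 else set0.
have mD n kl : measurable (D n kl).
  by rewrite /D; case: ifP => // _; apply: measurableX; exact: mi.
rewrite (_ : U = \bigcup_n \bigcup_k \bigcup_l D n (k, l)).
  by do 3 apply: bigcup_measurable => ? _.
apply/seteqP; split => [[x y] Uxy|z [n _ [k _ [l _]]]]; last first.
  by rewrite /D; case: asboolP => // + + /=; apply.
have : nbhs (x, y) U by apply: open_nbhs_nbhs.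
move=> [[A B] [/= /nbhs_ballP[e /= e0 eA] /nbhs_ballP[e' /= e'0 eB]] AB].
have m0 : 0 < Num.min e e' by rewrite lt_min e0.
have [n _ /(_ n (leqnn n)) /=] := near_infty_natSinv_lt (PosNum m0).
rewrite lt_min => /andP[ne ne'].
exists n => //; exists (i n x) => //; exists (i n y) => //.
rewrite /D ifT; first by split.
apply/asboolP => -[x' y'] [/= xx' yy']; apply: AB; split => /=.
  by apply: eA; rewrite ballEmdist/= (lt_trans _ ne)//; exact/di/esym.
by apply: eB; rewrite ballEmdist/= (lt_trans _ ne')//; exact/di/esym.
Qed.

Lemma measurable_borel_pair d (T : measurableType d)
    (f g : T -> borel X) :
  measurable_fun setT f -> measurable_fun setT g ->
  measurable_fun setT ((fun w => (f w, g w)) : T -> borel (X * X)%type).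
Proof.
move=> mf mg; apply: (@measurability _ _ _ (borel (X * X)%type) _ _ (@open (X * X)%type)) => //.
move=> _ [U oU <-].
have mfg : measurable_fun setT ((fun w => (f w, g w)) : T -> (borel X * borel X)%type).
  exact/measurable_fun_pair.
exact: mfg (open_measurable_prod oU).
Qed.

Lemma measurable_borel_fst :
  measurable_fun setT (fst : borel (X * X)%type -> borel X).
Proof. by apply: continuous_borel => z; exact: cvg_fst. Qed.

Lemma measurable_borel_snd :
  measurable_fun setT (snd : borel (X * X)%type -> borel X).
Proof. by apply: continuous_borel => z; exact: cvg_snd. Qed.

Definition sqdist (z : borel (X * X)%type) : R := mdist z.1 z.2 ^+ 2.

Lemma open_mdist_lt (a : R) : open [set z : X * X | mdist z.1 z.2 < a].
Proof.
rewrite openE => -[x y] /= xya.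
pose e := (a - mdist x y) / 2; have e0 : 0 < e by rewrite divr_gt0// subr_gt0.
exists (ball x e, ball y e) => /=; first by split; exact: nbhsx_ballx.
move=> [x' y'] [/=]; rewrite !ballEmdist/= => xx' yy'.
have := metric_triangle x' x y'; have := metric_triangle x y y'.
by rewrite (metric_sym x' x); rewrite /e in xx' yy'; lra.
Qed.

Lemma measurable_sqdist : measurable_fun setT sqdist.
Proof.
apply: measurable_funX.
apply: (measurability _ (RGenInftyO.measurableE R)) => //.
move=> _ [_ [a ->] <-]; rewrite setTI; apply: measurable_open.
rewrite (_ : _ @^-1` _ = [set z : X * X | mdist z.1 z.2 < a]).
  exact: open_mdist_lt.
by apply/seteqP; split => z /=; rewrite in_itv.
Qed.

Let measurable_cost : measurable_fun setT (EFin \o sqdist).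
Proof. by apply/measurable_EFinP; exact: measurable_sqdist. Qed.

Definition cost (p : probability (borel (X * X)%type) R) : \bar R :=
  (\int[p]_z (sqdist z)%:E)%E.

Lemma cost_ge0 p : (0 <= cost p)%E.
Proof. by apply: integral_ge0 => z _; rewrite lee_fin sqr_ge0. Qed.

Lemma exists_coupling (mu nu : Prob X) : exists p, coupling mu nu p.
Proof.
have mid : measurable_fun [set: (borel X * borel X)%type]
    ((fun z => (z.1, z.2)) : _ -> borel (X * X)%type).
  by apply: measurable_borel_pair; [exact: measurable_fst|exact: measurable_snd].
have [p pE] := exists_law (mu \x nu)%E mid; exists p; split=> A mA; rewrite pE.
- transitivity ((mu \x nu)%E (A `*` [set: borel X])).
    by congr ((_ \x _)%E _); apply/seteqP; split => z //= [].
  by rewrite product_measure1E// [X in (_ * X)%E]probability_setT mule1.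
- transitivity ((mu \x nu)%E ([set: borel X] `*` A)).
    by congr ((_ \x _)%E _); apply/seteqP; split => z //= [].
  by rewrite product_measure1E// [X in (X * _)%E]probability_setT mul1e.
Qed.

Hypothesis mdist_le1 : forall x y : X, mdist x y <= 1.

Lemma cost_le1 p : (cost p <= 1)%E.
Proof.
have -> : 1%E = (\int[p]_z cst 1 z)%E.
  by rewrite integral_cst// [X in (_ * X)%E]probability_setT mule1.
apply: ge0_le_integral => //= [z _|z _]; rewrite lee_fin ?sqr_ge0//.
by rewrite /sqdist expr_le1// mdist_ge0.
Qed.

Let inf_cost (mu nu : Prob X) : \bar R :=
  ereal_inf [set c | exists2 p, coupling mu nu p & c = cost p].

Let inf_cost_ge0 mu nu : (0 <= inf_cost mu nu)%E.
Proof. by apply: le_ereal_inf_tmp => _ [p _ ->]; exact: cost_ge0. Qed.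

Let inf_cost_le1 mu nu : (inf_cost mu nu <= 1)%E.
Proof.
have [p cp] := exists_coupling mu nu.
by apply: ge_ereal_inf; exists (cost p); [exists p|exact: cost_le1].
Qed.

Lemma wasserstein_sqE (mu nu : Prob X) :
  (wasserstein mu nu ^+ 2)%:E = inf_cost mu nu.
Proof.
have fi : inf_cost mu nu \is a fin_num.
  by rewrite ge0_fin_numE// (le_lt_trans (inf_cost_le1 _ _)) ?ltry.
rewrite /wasserstein -[ereal_inf _]/(inf_cost mu nu) sqr_sqrtr ?fineK//.
exact: fine_ge0.
Qed.

Lemma wasserstein_le1 (mu nu : Prob X) : wasserstein mu nu ^+ 2 <= 1.
Proof. by rewrite -lee_fin wasserstein_sqE. Qed.

Lemma wasserstein_le_cost (mu nu : Prob X) p : coupling mu nu p ->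
  ((wasserstein mu nu ^+ 2)%:E <= cost p)%E.
Proof.
by move=> cp; rewrite wasserstein_sqE; apply: ereal_inf_lbound; exists p.
Qed.

Lemma wasserstein_near_optimal (mu nu : Prob X) (e : R) : 0 < e ->
  exists2 p, coupling mu nu p & (cost p < (wasserstein mu nu ^+ 2 + e)%:E)%E.
Proof.
move=> e0.
have /ereal_inf_lt[_ [p cp ->] ?] :
    (inf_cost mu nu < (wasserstein mu nu ^+ 2 + e)%:E)%E.
  by rewrite -wasserstein_sqE lte_fin ltrDl.
by exists p.
Qed.

(** Let [x] and [y] be the end points and [z] the middle point. If
    [d(x,y)^2 + k <= 2 d(x,z)^2 + 2 d(z,y)^2] held on a set of positive measure,
    gluing near-optimal couplings of [(mu0, nu)] and [(nu, mu1)] would transport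
    [mu0] to [mu1] at a cost smaller than [d(mu0, mu1)^2]. In a Hilbert space the
    parallelogram law makes [k] the squared distance, up to a factor 4, from [z]
    to the midpoint of [x] and [y]. *)
Lemma midpoint_null (mu0 mu1 nu : Prob X) (A B : set (borel X)) (k : R) :
  measurable A -> measurable B -> 0 < k ->
  mu1 (~` A) = 0%E ->
  (forall x y z : X, A y -> B z -> mdist x y ^+ 2 + k <=
     2 * mdist x z ^+ 2 + 2 * mdist z y ^+ 2) ->
  wasserstein mu0 nu = 2^-1 * wasserstein mu0 mu1 ->
  wasserstein nu mu1 = 2^-1 * wasserstein mu0 mu1 ->
  nu B = 0%E.
Proof.
move=> mA mB k0 muA AB W0 W1.
set D := wasserstein mu0 mu1 in W0 W1.
(* The error is 4 e from the two near-optimal couplings and 6 e from the mesh. *)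
suff bound (e : R) : 0 < e -> (k%:E * nu B <= (10 * e)%:E)%E.
  have nuBfin : nu B \is a fin_num by exact: fin_num_measure.
  apply/eqP; rewrite eq_le measure_ge0 andbT -(fineK nuBfin) lee_fin.
  rewrite -(pmulr_rle0 _ k0); apply/ler_addgt0Pl => e e0; rewrite addr0.
  have := bound (e / 10) (divr_gt0 e0 _); rewrite -{1}(fineK nuBfin) -EFinM lee_fin.
  by move=> /(_ ltac:(lra)); lra.
move=> e0.
have [p [p0 pnu] cp] := wasserstein_near_optimal mu0 nu e0.
have [q [qnu q1] cq] := wasserstein_near_optimal nu mu1 e0.
have [c mc dc] := Xfine e0.
pose i : borel (X * X)%type -> nat := c \o snd.
pose j : borel (X * X)%type -> nat := c \o fst.
have mi : discrete_rv i.
  by move=> n; have := measurable_borel_snd measurableT (mc n); rewrite setTI.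
have mj : discrete_rv j.
  by move=> n; have := measurable_borel_fst measurableT (mc n); rewrite setTI.
have ij n : p (i @^-1` [set n]) = q (j @^-1` [set n]).
  by rewrite [LHS](pnu _ (mc n)) -(qnu _ (mc n)).
(* A point w of W is ((x, z), (z', y)) with z and z' in the same cell of mesh e. *)
pose P := glue p q mi mj.
pose W := (borel (X * X)%type * borel (X * X)%type)%type.
have m1 : measurable_fun setT (fun w : W => w.1 : borel (X * X)%type).
  exact: measurable_fst.
have m2 : measurable_fun setT (fun w : W => w.2 : borel (X * X)%type).
  exact: measurable_snd.
pose px (w : W) : borel X := w.1.1.
pose pz (w : W) : borel X := w.1.2.
pose py (w : W) : borel X := w.2.2.
have mx : measurable_fun setT px := measurableT_comp measurable_borel_fst m1.
have mz : measurable_fun setT pz := measurableT_comp measurable_borel_snd m1.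
have my : measurable_fun setT py := measurableT_comp measurable_borel_snd m2.
have mxy := measurable_borel_pair mx my.
have [r rE] := exists_law P mxy.
have Pp S : measurable S -> P (fst @^-1` S) = p S by exact: glue_fst.
have Pq S : measurable S -> P (snd @^-1` S) = q S by exact: glue_snd.
have Px S : measurable S -> P (px @^-1` S) = mu0 S.
  move=> mS; rewrite -p0// -Pp//.
  by have := measurable_borel_fst measurableT mS; rewrite setTI.
have Pz S : measurable S -> P (pz @^-1` S) = nu S.
  move=> mS; rewrite -pnu// -Pp//.
  by have := measurable_borel_snd measurableT mS; rewrite setTI.
have Py S : measurable S -> P (py @^-1` S) = mu1 S.
  move=> mS; rewrite -q1// -Pq//.
  by have := measurable_borel_snd measurableT mS; rewrite setTI.
have cr : coupling mu0 mu1 r.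
  by split=> S mS; rewrite rE; [exact: Px|exact: Py].
pose f1 (w : W) : \bar R :=
  (sqdist (w.1.1, w.2.2))%:E.
pose f2 (w : W) : \bar R :=
  (\1_B (w.1.2))%:E.
have If1 : (\int[P]_w f1 w = cost r)%E.
  apply: (ge0_integral_law mxy _ measurable_cost) => [S mS|y].
    exact: esym (rE S).
  by rewrite /= lee_fin sqr_ge0.
have mf1 : measurable_fun setT f1 by exact: measurableT_comp measurable_cost mxy.
have m1B : measurable_fun setT (EFin \o (\1_B : borel X -> R)).
  by apply/measurable_EFinP.
have mf2 : measurable_fun setT f2 by exact: measurableT_comp m1B mz.
have If2 : (\int[P]_w f2 w = nu B)%E.
  rewrite /f2 (ge0_integral_law mz Pz m1B) ?integral_indic ?setIT// => y.
  by rewrite /= lee_fin.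
have Icost1 : (\int[P]_w (sqdist w.1)%:E = cost p)%E.
  apply: (ge0_integral_law m1 Pp measurable_cost) => y.
  by rewrite /= lee_fin sqr_ge0.
have Icost2 : (\int[P]_w (sqdist w.2)%:E = cost q)%E.
  apply: (ge0_integral_law m2 Pq measurable_cost) => y.
  by rewrite /= lee_fin sqr_ge0.
have sq_ge0 z : (0 <= (sqdist z)%:E :> \bar R)%E by rewrite lee_fin sqr_ge0.
have f1_ge0 w : (0 <= f1 w)%E by exact: sq_ge0.
have f2_ge0 w : (0 <= f2 w)%E by rewrite lee_fin.
pose kf2 w := (k%:E * f2 w)%E.
pose g1 (w : W) : \bar R := (2%:E * (sqdist w.1)%:E)%E.
pose g2 (w : W) : \bar R := (2%:E * (sqdist w.2)%:E)%E.
have kf2_ge0 w : (0 <= kf2 w)%E by rewrite mule_ge0// lee_fin ltW.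
have g1_ge0 w : (0 <= g1 w)%E by rewrite mule_ge0.
have g2_ge0 w : (0 <= g2 w)%E by rewrite mule_ge0.
have mkf2 : measurable_fun setT kf2 by exact: measurable_funeM.
have mc1 : measurable_fun setT (fun w : W => (sqdist w.1)%:E).
  exact: measurableT_comp measurable_cost m1.
have mc2 : measurable_fun setT (fun w : W => (sqdist w.2)%:E).
  exact: measurableT_comp measurable_cost m2.
have mg1 : measurable_fun setT g1 by exact: measurable_funeM.
have mg2 : measurable_fun setT g2 by exact: measurable_funeM.
have key : (\int[P]_w (f1 w + kf2 w) <= \int[P]_w (g1 w + g2 w + (6 * e)%:E))%E.
  apply: ae_ge0_le_integral => //.
  - by move=> w _; rewrite adde_ge0.
  - exact: emeasurable_funD mf1 mkf2.
  - by move=> w _; rewrite !adde_ge0// lee_fin mulr_ge0// ltW.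
  - apply: emeasurable_funD (measurable_cst _).
    exact: emeasurable_funD mg1 mg2.
  have aeA : {ae P, forall w, A (py w)}.
    exists (py @^-1` (~` A)); split => //.
      by have := my measurableT _ (measurableC mA); rewrite setTI.
    by rewrite -muA -Py//; exact: measurableC.
  apply: filterS2 aeA (glue_diag mi mj ij) => w Ay /dc.
  rewrite /f1 /kf2 /f2 /g1 /g2 /sqdist -!EFinM -!EFinD lee_fin /=.
  rewrite -/(px w) -/(py w) -/(pz w); set z' := w.2.1 => zz' _.
  have c2 : mdist (pz w) (py w) ^+ 2 <= mdist z' (py w) ^+ 2 + 3 * e.
    have := metric_triangle (pz w) z' (py w); have := mdist_le1 (pz w) z'.
    have := mdist_le1 z' (py w); have := mdist_ge0 (pz w) z'.
    by have := mdist_ge0 z' (py w); have := mdist_ge0 (pz w) (py w); nra.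
  rewrite indicE; case: (boolP (pz w \in B)) => [|_].
    by rewrite inE => /(AB (px w) _ _ Ay) /=; lra.
  have a2 : mdist (px w) (py w) ^+ 2 <=
      (mdist (px w) (pz w) + mdist (pz w) (py w)) ^+ 2.
    by rewrite ler_pXn2r ?nnegrE ?addr_ge0 ?mdist_ge0//; exact: metric_triangle.
  have := sqr_ge0 (mdist (px w) (pz w) - mdist (pz w) (py w)).
  rewrite sqrrB; rewrite sqrrD in a2; rewrite /= mulr0 addr0; lra.
have : ((wasserstein mu0 mu1 ^+ 2)%:E + k%:E * nu B <=
  2%:E * (wasserstein mu0 nu ^+ 2 + e)%:E +
  2%:E * (wasserstein nu mu1 ^+ 2 + e)%:E + (6 * e)%:E)%E.
  apply: le_trans (le_trans key _).
    rewrite ge0_integralD// If1 ge0_integralZl// ?If2; last first.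
      by rewrite lee_fin ltW.
    by apply: leeD => //; exact: wasserstein_le_cost.
  rewrite ge0_integralD//; last 3 first.
  - by move=> w _; rewrite adde_ge0.
  - exact: emeasurable_funD mg1 mg2.
  - by move=> w _; rewrite lee_fin mulr_ge0// ltW.
  rewrite ge0_integralD// !ge0_integralZl// Icost1 Icost2.
  have -> : (\int[P]__ (6 * e)%:E = (6 * e)%:E)%E.
    by rewrite integral_cst// [X in (_ * X)%E](probability_setT P) mule1.
  by apply: leeD => //; apply: leeD; apply: lee_wpmul2l => //; apply: ltW.
have nuBfin : nu B \is a fin_num by exact: fin_num_measure.
rewrite -(fineK nuBfin) W0 W1 -/D -!EFinM -!EFinD !lee_fin => H.
by rewrite !exprMn in H; lra.
Qed.

End finely_partitioned.

(** * Entropy of conditioned measures *)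

(** Both integrals may be infinite: compare positive and negative parts separately. *)
Lemma ae_le_integral d (T : measurableType d) (R : realType)
    (m : {measure set T -> \bar R}) (g h : T -> \bar R) :
  measurable_fun setT g -> measurable_fun setT h ->
  {ae m, forall x, (g x <= h x)%E} ->
  (\int[m]_x g x <= \int[m]_x h x)%E.
Proof.
move=> mg mh gh; rewrite (integralE _ _ g) (integralE _ _ h); apply: leeB.
- apply: ae_ge0_le_integral => //; [exact: measurable_funepos..|].
  apply: filterS gh => x gh _; rewrite !funeposE ge_max le_max gh/=.
  by rewrite le_max lexx orbT.
- apply: ae_ge0_le_integral => //; [exact: measurable_funeneg..|].
  apply: filterS gh => x gh _; rewrite !funenegE ge_max le_max leeN2 gh/=.
  by rewrite le_max lexx orbT.
Qed.

(** The convex function [r ln r] lies above its tangent at [c]. *)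
Lemma xlnx_tangent (R : realType) (r c : R) : 0 <= r -> 0 < c ->
  r * ln c + r - c <= r * ln r.
Proof.
rewrite le_eqVlt => /predU1P[<-|r0] c0; first by rewrite !mul0r; lra.
have : ln (1 + (c / r - 1)) <= c / r - 1.
  by apply: le_ln1Dx; have := divr_gt0 c0 r0; lra.
rewrite addrC subrK ln_div ?posrE// => /(ler_wpM2l (ltW r0)).
by rewrite !mulrBr mulrCA divff ?gt_eqF// mulr1; lra.
Qed.

Section entropy.
Context {R : realType} {X : pmetricType R}.
Implicit Types (m mu nu : Prob X).

(** Representatives of the Radon-Nikodym derivative that are real and nonnegative
    everywhere, so that [r ln r] can be bounded pointwise. *)
Definition is_density nu m (r : borel X -> R) : Prop :=
  [/\ measurable_fun setT r, forall x, 0 <= r x &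
    forall A, measurable A -> nu A = (\int[m]_(x in A) (r x)%:E)%E].

Lemma density_integrable nu m r : is_density nu m r ->
  m.-integrable setT (EFin \o r).
Proof.
move=> [mr r0 rE]; apply/integrableP; split; first exact/measurable_EFinP.
under eq_integral do rewrite /= ger0_norm//.
by rewrite -(rE _ measurableT) [X in (X < _)%E]probability_setT ltry.
Qed.

Let measurable_xlnx (r : borel X -> R) : measurable_fun setT r ->
  measurable_fun setT (fun x => (r x * ln (r x))%:E).
Proof.
move=> mr; apply/measurable_EFinP; apply: measurable_funM => //.
exact: measurableT_comp.
Qed.

Lemma Ent_density nu m : nu `<< m -> exists2 r, is_density nu m r &
  Ent nu m = (\int[m]_x (r x * ln (r x))%:E)%E.
Proof.
move=> num; pose f := Radon_Nikodym_SigmaFinite.f nu m.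
have f0 x : (0 <= f x)%E by exact: Radon_Nikodym_SigmaFinite.f_ge0.
have ff x : f x \is a fin_num by exact: Radon_Nikodym_SigmaFinite.f_fin_num.
have intf := Radon_Nikodym_SigmaFinite.f_integrable num.
have mf : measurable_fun setT (fine \o f).
  by apply: measurableT_comp => //; exact: measurable_int intf.
exists (fine \o f).
  split=> // [x|A mA]; first exact: fine_ge0.
  rewrite (Radon_Nikodym_SigmaFinite.f_integral num)//.
  by apply: eq_integral => x _; rewrite /= fineK.
rewrite /Ent; case: pselect => // _ /=.
apply: ae_eq_integral => //.
- by apply: measurable_xlnx; apply: measurableT_comp.
- exact: measurable_xlnx.
- apply: filterS (ae_eq_Radon_Nikodym_SigmaFinite num measurableT) => x + _.
  by move=> /(_ I) <-.
Qed.

Lemma density_unique nu m r s : is_density nu m r -> is_density nu m s ->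
  ae_eq m setT r s.
Proof.
move=> dr ds; have [ms _ sE] := ds; have [_ _ rE] := dr.
have : ae_eq m setT (EFin \o r) (EFin \o s).
  apply: integral_ae_eq => //; first exact: density_integrable dr.
  - exact/measurable_EFinP.
  - by move=> E _ mE; rewrite -rE// -sE.
by apply: filterS => x /[apply] -[].
Qed.

Lemma density_null nu m r (A : set (borel X)) : is_density nu m r -> measurable A ->
  nu A = 0%E -> {ae m, forall x, A x -> r x = 0}.
Proof.
move=> [mr r0 rE] mA nuA.
have : (\int[m]_(x in A) `|(r x)%:E| = 0)%E.
  by under eq_integral do rewrite /= ger0_norm//; rewrite -rE.
have mrA : measurable_fun A (EFin \o r).
  by apply/measurable_EFinP; exact: measurable_funTS.
move=> /(ae_eq_integral_abs m mA mrA).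
by apply: filterS => x /[apply] -[].
Qed.

(** Jensen's inequality: among the measures carried by [A], the conditioned measure
    minimises the entropy. Integrate the tangent to [r ln r] at [c = 1 / m(A)] on
    [A]; outside [A] the density vanishes almost everywhere. *)
Lemma Ent_ge_supp nu m (A : set (borel X)) : measurable A -> nu (~` A) = 0%E ->
  ((- ln (fine (m A)))%:E <= Ent nu m)%E.
Proof.
move=> mA nuA; have [num|num] := pselect (nu `<< m); last first.
  have -> : Ent nu m = +oo%E by rewrite /Ent; case: pselect.
  exact: leey.
have [r dr ->] := Ent_density num; have [mr r0 rE] := dr.
have mAfin : m A \is a fin_num by exact: fin_num_measure.
have mA0 : 0 < fine (m A).
  rewrite lt_neqAle fine_ge0// andbT eq_sym fine_eq0//; apply/negP => /eqP mA0.
  have : nu A = 0%E by exact: (null_content_dominatesP _ _).1 num _ mA mA0.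
  move/eqP; rewrite -[A]setCK probability_setC; last exact: measurableC.
  by rewrite nuA sube0 onee_eq0.
pose c := (fine (m A))^-1; have c0 : 0 < c by rewrite invr_gt0.
rewrite -lnV//.
pose g x : \bar R := (r x * (ln c + 1) - c * \1_A x)%:E.
have intr := density_integrable dr.
have ig1 : m.-integrable setT (fun x => (ln c + 1)%:E * (r x)%:E)%E.
  exact: integrableZl intr.
have ig2 : m.-integrable setT (fun x => c%:E * (\1_A x)%:E)%E.
  by apply: integrableZl => //; exact: integrable_indic.
have -> : (ln c)%:E = (\int[m]_x g x)%E.
  rewrite (eq_integral (fun x => (ln c + 1)%:E * (r x)%:E - c%:E * (\1_A x)%:E)%E); last first.
    by move=> x _; rewrite /g -!EFinM -EFinB mulrC.
  rewrite integralB// integralZl// integralZl//; last exact: integrable_indic.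
  rewrite integral_indic// setIT -(rE _ measurableT) [X in (_ * X - _)%E]probability_setT.
  rewrite mule1 [X in (_ - _ * X)%E](esym (fineK mAfin)) -EFinM -EFinB /c mulVf ?gt_eqF//.
  by rewrite addrK.
apply: ae_le_integral => //.
- apply/measurable_EFinP; apply: measurable_funB; first exact: measurable_funM.
  by apply: measurable_funM.
- exact: measurable_xlnx.
- apply: filterS (density_null dr (measurableC mA) nuA) => x rx0.
  rewrite lee_fin indicE; case: (boolP (x \in A)) => [_|].
    by have := xlnx_tangent (r0 x) c0; rewrite mulr1; lra.
  by rewrite notin_setE => /rx0 ->; rewrite !mul0r mulr0 subr0.
Qed.

(** The measure [m] conditioned on [A] has density [1 / m(A)] on [A], so it attains
    the bound of [Ent_ge_supp]. *)
Lemma exists_conditioned m (A : set (borel X)) : measurable A ->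
  (0 < m A)%E -> exists mu : Prob X,
  [/\ mu `<< m, mu (~` A) = 0%E & Ent mu m = (- ln (fine (m A)))%:E].
Proof.
move=> mA mA0.
have mAfin : m A \is a fin_num by exact: fin_num_measure.
have {}mA0 : 0 < fine (m A) by rewrite fine_gt0// mA0 ltey_eq mAfin.
pose c := (fine (m A))^-1; have c0 : 0 < c by rewrite invr_gt0.
pose mu : Prob X := mnormalize (mrestr m mA) m.
have muE B : mu B = (c%:E * m (B `&` A))%E.
  rewrite /mu/= /mnormalize/= /mrestr setTI ifF 1?muleC//.
  by apply/negbTE; rewrite negb_or -(fineK mAfin) eqe gt_eqF.
have mum : mu `<< m.
  apply/null_content_dominatesP => B mB mB0; rewrite muE.
  by rewrite (subset_measure0 _ _ _ mB0) ?mule0//; exact: measurableI.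
exists mu; split => //; first by rewrite muE setICl measure0 mule0.
have [r dr ->] := Ent_density mum.
have ds : is_density mu m (fun x => c * \1_A x).
  split=> [|x|B mB].
  - by apply: measurable_funM.
  - by rewrite mulr_ge0// ltW.
  rewrite muE; under eq_integral do rewrite EFinM.
  rewrite ge0_integralZl//; last 2 first.
  - by apply/measurable_EFinP; exact: measurable_funTS.
  - by rewrite lee_fin ltW.
  by rewrite integral_indic// setIC.
have [mr _ _] := dr.
transitivity (\int[m]_x ((c * ln c)%:E * (\1_A x)%:E))%E.
  apply: ae_eq_integral => //.
  - exact: measurable_xlnx.
  - by apply: measurable_funeM; apply/measurable_EFinP.
  apply: filterS (density_unique dr ds) => x + _ => /(_ I) ->.
  rewrite indicE; case: (x \in A); first by rewrite !mulr1 mule1.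
  by rewrite !mulr0 mul0r mule0.
rewrite integralZl//; last exact: integrable_indic.
rewrite integral_indic// setIT [X in (_ * X)%E](esym (fineK mAfin)) -EFinM.
rewrite -lnV//.
by rewrite mulrAC /c mulVf ?gt_eqF// mul1r.
Qed.

End entropy.

(** * Geometry of the space of monotone functions *)

Section G0_geometry.
Context {R : realType}.
Implicit Types (g h x y z : G0 R) (s t u c : R).

Local Notation I01 := (`[0, 1[%classic : set R).

Lemma G0_eval01 g s : 0 <= s <= 1 -> 0 <= G0_eval g s <= 1.
Proof. by move=> s01; have [+ _ _] := rcfunP (repr g); apply. Qed.

Lemma G0_eval_nd g s t : 0 <= s -> s <= t -> t <= 1 ->
  G0_eval g s <= G0_eval g t.
Proof. by have [_ + _] := rcfunP (repr g); apply. Qed.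

Lemma G0_eval_rc g s : 0 <= s < 1 -> G0_eval g u @[u --> s^'+] --> G0_eval g s.
Proof. by move=> s01; have [_ _] := rcfunP (repr g); apply. Qed.

(** The half-open interval avoids the point 1, where the value of a representative
    is not determined by its class. *)
Lemma measurable_G0_eval g : measurable_fun I01 (G0_eval g).
Proof.
apply: measurable_funS (measurable_rcfun (repr g)); first exact: measurable_itv.
by apply: subset_itvl; rewrite bnd_simp.
Qed.

Lemma measurable_sqdiff g h :
  measurable_fun I01 (fun s => (G0_eval g s - G0_eval h s) ^+ 2).
Proof.
by apply: measurable_funX; apply: measurable_funB; exact: measurable_G0_eval.
Qed.

Let sqint g h : \bar R :=
  (\int[lebesgue_measure]_(s in I01) ((G0_eval g s - G0_eval h s) ^+ 2)%:E)%E.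

Let sqint_ge0 g h : (0 <= sqint g h)%E.
Proof. by apply: integral_ge0 => s _; rewrite lee_fin sqr_ge0. Qed.

Let sqint_le1 g h : (sqint g h <= 1)%E.
Proof.
have -> : 1%E = (\int[lebesgue_measure]_(s in I01) (cst 1%E s))%E :> \bar R.
  by rewrite integral_cst//= mul1e lebesgue_measure_itv/= lte_fin ltr01 oppr0 adde0.
apply: ge0_le_integral => //= [s _||s].
- by rewrite lee_fin sqr_ge0.
- by apply/measurable_EFinP; exact: measurable_sqdiff.
rewrite in_itv/= => /andP[s0 s1]; rewrite lee_fin -real_normK ?num_real//.
rewrite expr_le1//; have s01 : 0 <= s <= 1 by rewrite s0 ltW.
have /andP[g0 g1] := G0_eval01 g s01; have /andP[h0 h1] := G0_eval01 h s01.
by rewrite ler_norml; lra.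
Qed.

Lemma sqmdistE g h : (mdist g h ^+ 2)%:E =
  (\int[lebesgue_measure]_(s in I01) ((G0_eval g s - G0_eval h s) ^+ 2)%:E)%E.
Proof.
rewrite -[RHS]/(sqint g h) /mdist/= /G0_dist /L2dist /Rintegral.
have -> : (\int[lebesgue_measure]_(s in `[0%R, 1%R])
   ((repr g s - repr h s) ^+ 2)%:E)%E = sqint g h.
  rewrite -integral_itv_bndo_bndc//.
  by apply/measurable_EFinP; exact: measurable_sqdiff.
rewrite sqr_sqrtr ?fine_ge0// fineK//.
by rewrite ge0_fin_numE// (le_lt_trans (sqint_le1 _ _)) ?ltry.
Qed.

Lemma G0_dist_le1 g h : mdist g h <= 1.
Proof.
rewrite -(@expr_le1 _ 2)// ?mdist_ge0// -lee_fin sqmdistE; exact: sqint_le1.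
Qed.

Let integral_gap (k t s : R) : 0 <= k -> 0 <= t -> t <= s -> s <= 1 ->
  (\int[lebesgue_measure]_(u in I01) (k * \1_(`[t, s[) u)%:E =
   (k * (s - t))%:E)%E.
Proof.
move=> k0 t0 ts s1; under eq_integral do rewrite EFinM.
rewrite ge0_integralZl//; last first.
  by apply/measurable_EFinP; exact: measurable_indic.
rewrite integral_indic// setIidl; last first.
  by apply: subset_itv; rewrite bnd_simp.
rewrite [X in (_ * X)%E](lebesgue_measure_itv `[t, s[) /= lte_fin; case: ltP => [_|st].
  by rewrite EFinM EFinB.
by rewrite mule0 (_ : s = t) ?subrr ?mulr0//; apply/eqP; rewrite eq_le st ts.
Qed.

Lemma sqmdist_lower g h (a t s : R) : 0 <= a -> 0 <= t -> t <= s -> s <= 1 ->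
  (forall u, t <= u < s -> a <= G0_eval g u - G0_eval h u) ->
  a ^+ 2 * (s - t) <= mdist g h ^+ 2.
Proof.
move=> a0 t0 ts s1 gh; rewrite -lee_fin sqmdistE -integral_gap ?sqr_ge0//.
apply: ge0_le_integral => //= [u _|||u].
- by rewrite lee_fin mulr_ge0// sqr_ge0.
- by apply/measurable_EFinP; apply: measurable_funM => //; exact: measurable_indic.
- by apply/measurable_EFinP; exact: measurable_sqdiff.
rewrite in_itv/= lee_fin indicE => u01; case: (boolP (u \in _)) => [|_].
  rewrite inE/= in_itv/= mulr1 => /gh agh.
  by rewrite ler_pXn2r// nnegrE// (le_trans a0).
by rewrite mulr0 sqr_ge0.
Qed.

(** The parallelogram law, with the pointwise bound [(x + y) / 2 >= 1/4] and
    [z <= 1/8] on [[t, s[], whose gap contributes [4 * (1/8)^2 = 1/16]. *)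
Lemma sqmdist_midpoint x y z (t s : R) : 0 <= t -> t <= s -> s < 1 ->
  2^-1 <= G0_eval y t -> G0_eval z s <= 8^-1 ->
  mdist x y ^+ 2 + 16^-1 * (s - t) <= 2 * mdist x z ^+ 2 + 2 * mdist z y ^+ 2.
Proof.
move=> t0 ts s1 yt zs; rewrite -lee_fin !EFinD [(2 * _)%:E]EFinM [X in (_ <= _ + X)%E]EFinM.
rewrite !sqmdistE -integral_gap//; last exact: ltW.
pose q g h u : \bar R := ((G0_eval g u - G0_eval h u) ^+ 2)%:E.
pose k u : \bar R := (16^-1 * \1_(`[t, s[) u)%:E.
have mq g h : measurable_fun I01 (q g h).
  by apply/measurable_EFinP; exact: measurable_sqdiff.
have q0 g h u : (0 <= q g h u)%E by rewrite lee_fin sqr_ge0.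
have mk : measurable_fun I01 k.
  by apply/measurable_EFinP; apply: measurable_funM => //; exact: measurable_indic.
have k0 u : (0 <= k u)%E by rewrite lee_fin mulr_ge0.
have mD := measurable_itv `[0, 1[ : measurable I01.
have -> : (\int[lebesgue_measure]_(u in I01) q x y u +
   \int[lebesgue_measure]_(u in I01) k u =
   \int[lebesgue_measure]_(u in I01) (q x y u + k u))%E.
  by rewrite ge0_integralD//; exact: mq.
have -> : (2 * \int[lebesgue_measure]_(u in I01) q x z u +
   2 * \int[lebesgue_measure]_(u in I01) q z y u =
   \int[lebesgue_measure]_(u in I01) (2 * q x z u + 2 * q z y u))%E.
  rewrite ge0_integralD ?ge0_integralZl//; do ?[exact: mq].
  - by move=> u _; rewrite mule_ge0.
  - by apply: measurable_funeM; exact: mq.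
  - by move=> u _; rewrite mule_ge0.
  - by apply: measurable_funeM; exact: mq.
apply: ge0_le_integral => //=.
- by move=> u _; rewrite adde_ge0.
- by apply: emeasurable_funD => //; exact: mq.
- by apply: emeasurable_funD; apply: measurable_funeM; exact: mq.
move=> u; rewrite in_itv/= => /andP[u0 u1]; rewrite /q /k -!EFinM -!EFinD lee_fin.
have u01 : 0 <= u <= 1 by rewrite u0 ltW.
have /andP[x0 _] := G0_eval01 x u01.
rewrite indicE; case: (boolP (u \in _)) => [|_].
  rewrite inE/= in_itv/= => /andP[tu us].
  have yu : 2^-1 <= G0_eval y u by rewrite (le_trans yt)// G0_eval_nd// ltW.
  have zu : G0_eval z u <= 8^-1 by rewrite (le_trans _ zs)// G0_eval_nd// ltW.
  set a := G0_eval x u in x0 *; set b := G0_eval y u in yu *.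
  set c := G0_eval z u in zu *.
  have : 0 <= ((a + b) / 2 - c - 8^-1) * ((a + b) / 2 - c + 8^-1).
    by apply: mulr_ge0; lra.
  by rewrite mulr1; nra.
set a := G0_eval x u; set b := G0_eval y u; set c := G0_eval z u.
by have := sqr_ge0 (a + b - 2 * c); rewrite mulr0; nra.
Qed.

(** If [g t < c], right continuity keeps [g] below some [c' < c] on an interval
    [[t, s[], while a function that reaches [c] at [t] stays above [c] there; this
    forces a definite distance between the two. So evaluations at a point,
    although not continuous, are Borel. *)
Lemma closed_G0_eval_ge t c : 0 <= t < 1 -> closed [set g | c <= G0_eval g t].
Proof.
move=> t01; have /andP[t0 t1] := t01.
rewrite -[X in closed X]setCK; apply: open_closedC; rewrite openE => g /= /negP.
rewrite -ltNge => gc; pose c' := (G0_eval g t + c) / 2.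
have gc' : G0_eval g t < c' by rewrite /c'; lra.
have [e /= e0 He] : \forall u \near t^'+, G0_eval g u < c'.
  by apply: (cvgr_lt (G0_eval g t)) => //; exact: G0_eval_rc.
pose s : R := Num.min (t + e / 2) ((t + 1) / 2).
have ts : t < s by rewrite /s lt_min; apply/andP; split; lra.
have s1 : s < 1 by rewrite /s gt_min; apply/orP; right; lra.
have gs : G0_eval g s < c'.
  apply: He => //=; rewrite ltr0_norm ?subr_lt0// opprB.
  have : s <= t + e / 2 by rewrite /s ge_min lexx.
  by lra.
have k0 : 0 < (c - c') ^+ 2 * (s - t).
  by rewrite mulr_gt0 ?exprn_gt0 ?subr_gt0// /c'; lra.
apply/nbhs_ballP; exists (Num.sqrt ((c - c') ^+ 2 * (s - t))) => /=.
  by rewrite sqrtr_gt0.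
move=> h; rewrite ballEmdist/= => gh; apply/negP; rewrite -ltNge ltNge; apply/negP => hc.
have : (c - c') ^+ 2 * (s - t) <= mdist h g ^+ 2.
  apply: sqmdist_lower => //; [by rewrite /c'; lra|exact: ltW|exact: ltW|].
  move=> u /andP[tu us]; apply: lerB.
    by rewrite (le_trans hc)// G0_eval_nd//; lra.
  by rewrite (le_trans _ (ltW gs))// G0_eval_nd//; lra.
apply/negP; rewrite -ltNge metric_sym -[ltRHS]sqr_sqrtr; last exact: ltW.
by rewrite ltr_pXn2r// nnegrE ?mdist_ge0// sqrtr_ge0.
Qed.

Lemma measurable_G0_eval_ge t c : 0 <= t < 1 ->
  measurable ([set g | c <= G0_eval g t] : set (borel (G0 R))).
Proof. by move=> t01; apply: measurable_closed; exact: closed_G0_eval_ge. Qed.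


(** On [[i/n, (i+1)/n[] monotonicity bounds the difference by the increment of [g]
    between the end points plus [1/n]; the increments telescope to at most 1. *)
Lemma sqmdist_grid n g h : (0 < n)%N ->
  (forall i, (i < n)%N ->
    `|G0_eval g (i%:R / n%:R) - G0_eval h (i%:R / n%:R)| <= n%:R^-1) ->
  mdist g h ^+ 2 <= 2 / n%:R.
Proof.
move=> n0 gh; have nR0 : 0 < n%:R :> R by rewrite ltr0n.
(* The value at 1 is replaced by the upper bound 1 common to all classes. *)
pose G f i : R := if (i < n)%N then G0_eval f (i%:R / n%:R) else 1.
pose c i : R := G g i.+1 - G g i + n%:R^-1.
have grid01 i : (i < n)%N -> 0 <= (i%:R / n%:R : R) < 1.
  move=> lin; rewrite divr_ge0 ?ler0n//= ltr_pdivrMr// mul1r ltr_nat.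
  by [].
have G_ub f i s : (i < n)%N -> i%:R / n%:R <= s -> s < i.+1%:R / n%:R ->
    G f i <= G0_eval f s <= G f i.+1.
  move=> lin ins sin; have /andP[i0 i1] := grid01 _ lin.
  have s0 : 0 <= s by exact: le_trans ins.
  have s1 : s <= 1.
    by rewrite (le_trans (ltW sin))// ler_pdivrMr// mul1r ler_nat.
  rewrite /G lin G0_eval_nd//=; case: ifPn => [liSn|_].
    by rewrite G0_eval_nd//; [exact: ltW|case/andP: (grid01 _ liSn) => _ /ltW].
  have s01 : 0 <= s <= 1 by rewrite s0.
  by case/andP: (G0_eval01 f s01).
have gG i : (i <= n)%N -> `|G g i - G h i| <= n%:R^-1.
  rewrite /G leq_eqVlt => /predU1P[->|lin]; last by rewrite lin; exact: gh.
  by rewrite ltnn subrr normr0 invr_ge0 ltW.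
have G01 f i : 0 <= G f i <= 1.
  rewrite /G; case: ifPn => [lin|_]; last by rewrite ler01 lexx.
  by apply: G0_eval01; case/andP: (grid01 _ lin) => -> /ltW.
have dif i s : (i < n)%N -> i%:R / n%:R <= s -> s < i.+1%:R / n%:R ->
    `|G0_eval g s - G0_eval h s| <= c i.
  move=> lin ins sin; have /andP[g1 g2] := G_ub g i s lin ins sin.
  have /andP[h1 h2] := G_ub h i s lin ins sin.
  have := gG _ (ltnW lin); have := gG _ lin; rewrite /c !ler_norml.
  by move=> /andP[? ?] /andP[? ?]; apply/andP; split; lra.
have c0 i : (i < n)%N -> 0 <= c i.
  move=> lin; apply: le_trans (dif i (i%:R / n%:R) lin (lexx _) _) => //.
  by rewrite ltr_pM2r ?invr_gt0// ltr_nat.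
pose J i : set R := `[i%:R / n%:R, i.+1%:R / n%:R[%classic.
have -> : 2 / n%:R = n%:R^-1 * 2 :> R by rewrite mulrC.
apply: (@le_trans _ _ (n%:R^-1 * (G g n - G g 0%N + 1))); last first.
  rewrite ler_pM2l ?invr_gt0//; have /andP[? _] := G01 g 0%N.
  by have /andP[_ ?] := G01 g n; lra.
have <- : \sum_(0 <= i < n) c i * n%:R^-1 = n%:R^-1 * (G g n - G g 0%N + 1).
  rewrite -mulr_suml mulrC; congr (_ * _).
  rewrite big_split/= telescope_sumr// sumr_const_nat subn0.
  by rewrite -[_ *+ n]mulr_natr mulVf ?gt_eqF.
rewrite -lee_fin sqmdistE.
have cJ i : (i < n)%N -> (\int[lebesgue_measure]_(u in I01) (c i * \1_(J i) u)%:E =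
   (c i * n%:R^-1)%:E)%E.
  move=> lin; have /andP[i0 i1] := grid01 _ lin.
  have -> : n%:R^-1 = i.+1%:R / n%:R - i%:R / n%:R :> R.
    by rewrite -mulrBl -natr1 addrC addKr mul1r.
  rewrite integral_gap//; first exact: c0.
    by rewrite ler_pM2r ?invr_gt0// ler_nat.
  by rewrite ler_pdivrMr// mul1r ler_nat.
have mcJ i : measurable_fun I01 (fun u => (c i * \1_(J i) u)%:E : \bar R).
  apply/measurable_EFinP; apply: measurable_funM => //.
  by apply: measurable_indic; exact: measurable_itv.
have -> : (\sum_(0 <= i < n) c i * n%:R^-1)%:E =
    (\int[lebesgue_measure]_(u in I01) \sum_(0 <= i < n) (c i * \1_(J i) u)%:E)%E.
  rewrite big_mkord; under eq_integral do rewrite big_mkord.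
  rewrite ge0_integral_sum//.
  - by rewrite -sumEFin; apply: eq_bigr => i _; rewrite cJ.
  - by move=> i; exact: mcJ.
  - by move=> i u _; rewrite lee_fin mulr_ge0// c0.
apply: ge0_le_integral => //=.
- by move=> u _; rewrite lee_fin sqr_ge0.
- by apply/measurable_EFinP; exact: measurable_sqdiff.
- by apply: emeasurable_sum => i; exact: mcJ.
move=> s; rewrite in_itv/= => /andP[s0 s1].
have ns0 : 0 <= s * n%:R by rewrite mulr_ge0// ler0n.
pose i := Num.truncn (s * n%:R).
have lin : (i < n)%N by rewrite /i truncn_lt_nat// -ltr_pdivlMr// divff ?gt_eqF.
have /andP[ins sin] : i%:R / n%:R <= s < i.+1%:R / n%:R.
  by rewrite ler_pdivrMr// ltr_pdivlMr//; exact: truncn_itv.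
rewrite big_mkord (bigD1 (Ordinal lin))//=.
apply: (@le_trans _ _ (c i)%:E); last first.
  rewrite indicE mem_set ?mulr1; last by rewrite /J/= in_itv/= ins sin.
  by rewrite leeDl// sume_ge0// => j _; rewrite lee_fin mulr_ge0// c0.
rewrite lee_fin -real_normK ?num_real//.
have le1 : `|G0_eval g s - G0_eval h s| <= 1.
  have s01 : 0 <= s <= 1 by rewrite s0 ltW.
  have /andP[? ?] := G0_eval01 g s01; have /andP[? ?] := G0_eval01 h s01.
  by rewrite ler_norml; lra.
apply: le_trans (dif i s lin ins sin); rewrite expr2.
by rewrite ler_piMl.
Qed.

(** Functions whose values on a fine grid agree after truncation are close, and
    there are countably many sequences of truncated values. *)
Lemma G0_finely_partitioned : finely_partitioned (G0 R).
Proof.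
move=> r r0.
have [n n0 nr] : exists2 n, (0 < n)%N & 2 / n%:R < r ^+ 2 :> R.
  exists (Num.truncn (2 / r ^+ 2)).+1 => //.
  by rewrite ltr_pdivrMr ?ltr0n// mulrC -ltr_pdivrMr ?exprn_gt0// truncnS_gt.
have nR0 : 0 < n%:R :> R by rewrite ltr0n.
pose lab (g : borel (G0 R)) i := Num.truncn (n%:R * G0_eval g (i%:R / n%:R)).
pose L g := [seq lab g i | i <- iota 0 n].
have LP g h : L g = L h <-> forall i, (i < n)%N -> lab g i = lab h i.
  split=> [/eq_in_map gh i lin|gh]; first by apply: gh; rewrite mem_iota.
  by apply/eq_in_map => i; rewrite mem_iota => /gh.
have ev_ge0 (g : G0 R) i : (i < n)%N -> 0 <= n%:R * G0_eval g (i%:R / n%:R).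
  move=> lin; rewrite mulr_ge0 ?ler0n//.
  have i01 : 0 <= (i%:R / n%:R : R) <= 1.
    by rewrite divr_ge0 ?ler0n//= ler_pdivrMr// mul1r ler_nat ltnW.
  by case/andP: (G0_eval01 g i01).
exists (pickle \o L) => [k|g h /= /(pcan_inj pickleK)/LP gh].
  have [[g gk]|nk] := pselect (exists g, pickle (L g) = k); last first.
    rewrite (_ : _ @^-1` _ = set0); first exact: measurable0.
    by apply/seteqP; split => // g /= gk; apply: nk; exists g.
  rewrite (_ : _ @^-1` _ = \bigcap_(i in `I_n) [set h | lab h i = lab g i]).
    apply: bigcap_measurable => [|i /= lin]; first by exists 0%N.
    have i01 : 0 <= (i%:R / n%:R : R) < 1.
      by rewrite divr_ge0 ?ler0n//= ltr_pdivrMr// mul1r ltr_nat.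
    rewrite (_ : [set _ | _] =
      [set h | (lab g i)%:R / n%:R <= G0_eval h (i%:R / n%:R)] `\`
      [set h | (lab g i).+1%:R / n%:R <= G0_eval h (i%:R / n%:R)]).
      by apply: measurableD; exact: measurable_G0_eval_ge.
    apply/seteqP; split => h /=.
      move=> <-; have := truncn_itv (ev_ge0 h i lin); rewrite -/(lab h i).
      rewrite !ler_pdivrMr// ![_ * n%:R]mulrC => /andP[? ?].
      by split => //; apply/negP; rewrite -ltNge.
    rewrite !ler_pdivrMr// ![_ * n%:R]mulrC => -[le_lab /negP]; rewrite -ltNge => lt_lab.
    by apply/eqP; rewrite truncn_eq ?ev_ge0// le_lab.
  apply/seteqP; split => h /=.
    by rewrite -gk => /(pcan_inj pickleK)/LP gh i /= lin; exact: gh.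
  by move=> gh; rewrite -gk; congr pickle; apply/LP => i lin; exact: gh.
rewrite -(@ltr_pXn2r _ 2)// ?nnegrE ?mdist_ge0 ?ltW//.
apply: le_lt_trans nr; apply: sqmdist_grid => // i lin.
have := truncn_itv (ev_ge0 g i lin); have := truncn_itv (ev_ge0 h i lin).
rewrite -/(lab g i) -/(lab h i) (gh _ lin) -!natr1 => /andP[h1 h2] /andP[g1 g2].
rewrite -(ler_pM2l nR0) mulfV ?gt_eqF// -{1}(ger0_norm (ltW nR0)) -normrM.
rewrite mulrBr ler_norml.
by apply/andP; split; lra.
Qed.

End G0_geometry.

(** * One-dimensional marginals of the entropic measure *)

Section one_dimensional_marginal.
Context {R : realType}.

Local Notation U01 := (`]0, 1[%classic : set R).

Lemma measurable_G0_eval_at (t : R) : 0 <= t < 1 ->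
  measurable_fun setT (fun g : borel (G0 R) => G0_eval g t).
Proof.
move=> t01; apply: (measurability _ (RGenCInfty.measurableE R)) => //.
move=> _ [_ [c ->] <-]; rewrite setTI.
rewrite (_ : _ @^-1` _ = [set g : G0 R | c <= G0_eval g t]).
  exact: measurable_G0_eval_ge.
by apply/seteqP; split => g /=; rewrite in_itv/= andbT.
Qed.

(** The unnormalised density of the Beta(beta t, beta (1 - t)) law, which is the law
    of [g t] under the entropic measure. *)
Definition beta_weight (beta t x : R) : R :=
  x `^ (beta * t - 1) * (1 - x) `^ (beta * (1 - t) - 1).

Definition beta_int (beta t : R) (S : set R) : \bar R :=
  (\int[lebesgue_measure]_(x in S) (beta_weight beta t x)%:E)%E.

Lemma beta_weight_ge0 beta t x : 0 <= beta_weight beta t x.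
Proof. by rewrite mulr_ge0// powR_ge0. Qed.

Lemma measurable_beta_weight beta t (S : set R) : measurable_fun S (beta_weight beta t).
Proof.
apply: measurable_funTS; apply: measurable_funM; first exact: measurable_powR.
apply: (measurableT_comp (measurable_powR _)).
exact: measurable_funB.
Qed.

Lemma beta_int_ge0 beta t S : (0 <= beta_int beta t S)%E.
Proof. by apply: integral_ge0 => x _; rewrite lee_fin beta_weight_ge0. Qed.

Let hd (x : 1.-tuple (measurableTypeR R)) : measurableTypeR R := thead x.

Let measurable_hd : measurable_fun setT hd.
Proof. exact: measurable_tnth. Qed.

Let lebesgue_tuple1 (A : set (measurableTypeR R)) : measurable A ->
  lebesgue_tuple 1 (hd @^-1` A) = lebesgue_measure A.
Proof.
move=> mA; rewrite /= /lebesgue_cons /pushforward.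
transitivity ((@lebesgue_measure R \x \d_[tuple])%E (A `*` [set: 0.-tuple (measurableTypeR R)])).
  by congr ((_ \x _)%E _); apply/seteqP; split => -[x y] //= [].
by rewrite product_measure1E//= diracT mule1.
Qed.

Let hdE (x : 1.-tuple (measurableTypeR R)) : val x = [:: hd x].
Proof. by case: x => -[|a []]. Qed.

Let simplex1 : @simplex R 1 = hd @^-1` U01.
Proof.
by apply/seteqP; split=> x; rewrite /simplex /partition01 /= -/(val x) hdE/= in_itv/= andbT.
Qed.

Lemma integral_simplex1 (f : R -> \bar R) :
  measurable_fun U01 f -> (forall x, 0 <= f x)%E ->
  (\int[lebesgue_tuple 1]_(x in @simplex R 1) f (hd x) =
   \int[lebesgue_measure]_(x in U01) f x)%E.
Proof.
move=> mf f0; rewrite simplex1.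
rewrite -[LHS](@ge0_integral_pushforward _ _ _ _ _ _ measurable_hd (lebesgue_tuple 1) U01 f)//.
by apply: eq_measure_integral => A mA _; exact: lebesgue_tuple1.
Qed.

(** The normalising constant is kept abstract: only ratios of probabilities at the
    same [t] will matter. *)
Lemma entropic_marginal (beta : R) (Q : Prob (G0 R)) (t : R) :
  is_entropic_measure beta Q -> 0 < t < 1 ->
  exists Z : R, forall S : set R, measurable S ->
    Q [set g | S (G0_eval g t)] = (Z%:E * beta_int beta t (U01 `&` S))%E.
Proof.
move=> QE /andP[t0 t1]; have t01 : 0 <= t < 1 by rewrite ltW.
pose tt : 1.-tuple R := [tuple t].
have ptt : partition01 tt by rewrite /partition01/= t0 t1.
exists (Gamma beta / \prod_(i < 2) Gamma (beta * (knot tt i.+1 - knot tt i))).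
move=> S mS; pose u (x : 1.-tuple (measurableTypeR R)) : R := \1_S (hd x).
have mu : measurable_fun (@unit_cube R 1) u.
  apply: measurable_funTS; apply: measurableT_comp measurable_hd.
  exact: measurable_indic.
have bu : exists M : R, forall x, @unit_cube R 1 x -> `|u x| <= M.
  by exists 1 => x _; rewrite /u indicE; case: (_ \in _); rewrite ?normr1 ?normr0.
pose E : set (borel (G0 R)) := [set g | S (G0_eval g t)].
have mE : measurable E.
  by rewrite -[X in measurable X]setTI; exact: measurable_G0_eval_at.
have := QE _ tt ptt u mu bu.
rewrite -[[set g | _]]/E (eq_integral (fun g : borel (G0 R) => (\1_E g)%:E)); last first.
  move=> g _; rewrite /u /hd /thead !tnth_map/= !indicE.
  by congr (_%:R%:E); apply/idP/idP; rewrite !inE.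
rewrite integral_indic// setIT => ->; congr (_ * _)%E.
rewrite /beta_int integral_mkcondr.
rewrite -(@integral_simplex1 ((fun x => (beta_weight beta t x)%:E) \_ S)).
- apply: eq_integral => x _; rewrite !big_ord_recl big_ord0 mulr1/= patchE /u indicE.
  rewrite /knot -/(val x) hdE /= !subr0 /beta_weight.
  by case: (_ \in _); rewrite ?mul1r ?mul0r.
- apply/measurable_restrict => //; apply/measurable_EFinP.
  exact: measurable_beta_weight.
- by move=> x; rewrite patchE; case: ifP => // _; rewrite lee_fin beta_weight_ge0.
Qed.
(** Total mass 1 forces the constant to be positive and the Beta integral to be
    finite, without evaluating Gamma functions. *)
Lemma entropic_marginal_pos (beta : R) (Q : Prob (G0 R)) (t : R) :
  is_entropic_measure beta Q -> 0 < t < 1 ->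
  exists2 Z : R, 0 < Z & beta_int beta t U01 \is a fin_num /\
  forall S : set R, measurable S ->
    Q [set g | S (G0_eval g t)] = (Z%:E * beta_int beta t (U01 `&` S))%E.
Proof.
move=> QE t01; have [Z QZ] := entropic_marginal QE t01.
have QT : (Z%:E * beta_int beta t U01 = 1)%E.
  rewrite -[U01]setIT -(QZ _ measurableT) -(probability_setT Q).
  by congr (Q _); apply/seteqP; split.
have Z0 : 0 < Z.
  rewrite ltNge; apply/negP => Z0; have := @lte01 R.
  rewrite -QT ltNge => /negP; apply.
  by rewrite mule_le0_ge0// ?lee_fin// beta_int_ge0.
exists Z => //; split => //; rewrite ge0_fin_numE ?beta_int_ge0// ltey.
by apply/eqP => Ioo; move: QT; rewrite Ioo gt0_muley// lte_fin.
Qed.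

End one_dimensional_marginal.

(** * Bounds on Beta integrals *)

Section beta_integral_bounds.
Context {R : realType}.
Implicit Types (beta t x : R).

Local Notation mu := (@lebesgue_measure R).
Local Notation ico a b := (`[a%R, b%R[%classic : set R).
Local Notation ioo a b := (`]a%R, b%R[%classic : set R).

Lemma integral_ico_ge (a b k : R) (f : R -> R) : a <= b -> 0 <= k ->
  measurable_fun (ico a b) f -> (forall x, a <= x < b -> k <= f x) ->
  ((k * (b - a))%:E <= \int[mu]_(x in ico a b) (f x)%:E)%E.
Proof.
move=> ab k0 mf kf; have -> : (k * (b - a))%:E = (k%:E * mu (ico a b))%E.
  rewrite lebesgue_measure_itv/= lte_fin; case: ltP => [_|ba].
    by rewrite EFinM EFinB.
  by rewrite mule0 (_ : b = a) ?subrr ?mulr0//; apply/eqP; rewrite eq_le ba ab.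
rewrite -integral_cst//.
by apply: ge0_le_integral => //=; apply/measurable_EFinP.
Qed.

(** Each dyadic interval [[d/2, d[] contributes at least 1/2 to the integral of
    [1/x]. The power [-1] of [powR] agrees with the inverse on positive reals. *)
Lemma integral_inv_dyadic (M : nat) :
  ((M%:R / 2)%:E <=
     \int[mu]_(x in ico (4^-1 / 2 ^+ M) 4^-1) (x `^ (-1))%:E)%E.
Proof.
have minv (S : set R) : measurable_fun S (fun x : R => (x `^ (-1))%:E).
  by apply/measurable_EFinP; apply: measurable_funTS; exact: measurable_powR.
elim: M => [|M IH].
  by rewrite mul0r; apply: integral_ge0 => x _; rewrite lee_fin powR_ge0.
pose d : R := 4^-1 / 2 ^+ M.
have d0 : 0 < d by rewrite divr_gt0 ?exprn_gt0.
have d4 : d <= 4^-1 by rewrite ler_piMr// invf_le1 ?exprn_gt0// exprn_ege1// ler1n.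
have -> : 4^-1 / 2 ^+ M.+1 = d / 2 by rewrite /d exprS invfM mulrCA mulrC.
have -> : ico (d / 2) 4^-1 = ico (d / 2) d `|` ico d 4^-1.
  by rewrite -(@itv_bndbnd_setU _ _ _ (BLeft d))// bnd_simp; lra.
rewrite ge0_integral_setU//=; last 3 first.
- exact: minv.
- by move=> x /= _; rewrite lee_fin powR_ge0.
- by apply/disj_set2P; rewrite -subset0 => x [/=]; rewrite !in_itv/=; lra.
rewrite -natr1 mulrDl EFinD addeC; apply: leeD => //.
apply: le_trans (@integral_ico_ge _ _ d^-1 _ _ _ _ _).
- rewrite lee_fin (_ : d - d / 2 = d / 2); last by lra.
  by rewrite mulrA mulVf ?gt_eqF.
- by lra.
- by rewrite invr_ge0 ltW.
- by apply: measurable_funTS; exact: measurable_powR.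
move=> x /andP[x1 x2].
by rewrite powR_inv1 ?lef_pV2 ?posrE ?(ltW x2)//; lra.
Qed.

Lemma beta_int_ge_mid beta t : 0 < beta -> 0 < t -> t <= 2^-1 -> beta * t <= 1 ->
  ((4^-1 `^ beta / 4)%R%:E <= beta_int beta t (ico 2^-1 1))%E.
Proof.
move=> b0 t0 t2 bt1.
apply: (@le_trans _ _ (beta_int beta t (ico 2^-1 (3 / 4)))); last first.
  apply: ge0_subset_integral => //=.
  - by apply/measurable_EFinP; exact: measurable_beta_weight.
  - by move=> x _; rewrite lee_fin beta_weight_ge0.
  - by apply: subset_itvl; rewrite bnd_simp; lra.
apply: le_trans (@integral_ico_ge _ _ (4^-1 `^ beta) _ _ _ _ _).
- by rewrite lee_fin ler_wpM2l ?powR_ge0//; lra.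
- by lra.
- exact: powR_ge0.
- exact: measurable_beta_weight.
move=> x /andP[x1 x2].
rewrite /beta_weight -[leLHS]mul1r; apply: ler_pM => //; rewrite ?powR_ge0//.
  rewrite -{1}(powRr0 x); apply: ger_powR; lra.
have bt0 : 0 < beta * t by rewrite mulr_gt0.
apply: (@le_trans _ _ ((1 - x) `^ beta)).
  by apply: ge0_ler_powR; rewrite ?nnegrE; lra.
by apply: ger_powR; rewrite ?mulrBr; lra.
Qed.

(** Away from 0 the weight is dominated by a multiple, independent of [t], of the
    weight at time 1/2. *)
Lemma beta_int_le_away0 beta t : 0 < beta -> 0 < t -> t <= 2^-1 -> beta * t <= 1 ->
  (beta_int beta t (ico 8^-1 1) <=
   (8 / 8^-1 `^ beta)%:E * beta_int beta 2^-1%R (ioo 0 1))%E.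
Proof.
move=> b0 t0 t2 bt1; have d0 : 0 < (8^-1 : R) `^ beta by rewrite powR_gt0.
have k0 : 0 <= 8 / (8^-1 : R) `^ beta by rewrite divr_ge0 ?ltW.
have mw s (S : set R) : measurable_fun S (fun x => (beta_weight beta s x)%:E : \bar R).
  by apply/measurable_EFinP; exact: measurable_beta_weight.
have w0 s x : (0 <= (beta_weight beta s x)%:E :> \bar R)%E.
  by rewrite lee_fin beta_weight_ge0.
apply: (@le_trans _ _ ((8 / 8^-1 `^ beta)%:E * beta_int beta 2^-1%R (ico 8^-1 1))%E); last first.
  apply: lee_wpmul2l; first by rewrite lee_fin.
  apply: ge0_subset_integral => //=; first exact: mw.
  by apply: subset_itv; rewrite bnd_simp//; lra.
rewrite /beta_int -ge0_integralZl//; last exact: mw.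
apply: ge0_le_integral => //=.
- exact: mw.
- by apply: measurable_funeM; exact: mw.
move=> x; rewrite in_itv/= => /andP[]; move: x => x x1 x2.
rewrite -EFinM lee_fin /beta_weight mulrA.
have bt0 : 0 < beta * t by rewrite mulr_gt0.
have bt2 : beta * t <= beta * 2^-1 by rewrite ler_pM2l.
have x01 : 0 < x <= 1 by lra.
apply: ler_pM; rewrite ?powR_ge0//; last first.
  by apply: ger_powR; rewrite ?mulrBr; lra.
apply: (@le_trans _ _ 8).
  apply: (@le_trans _ _ (x `^ (-1))); first by apply: ger_powR => //; lra.
  rewrite powR_inv1; last by lra.
  by rewrite -[leRHS]invrK lef_pV2 ?posrE//; lra.
rewrite -mulrA ler_peMr// ler_pdivlMl// mulr1.
apply: (@le_trans _ _ (x `^ beta)).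
  by apply: ge0_ler_powR; rewrite ?nnegrE; lra.
by apply: ger_powR => //; lra.
Qed.

(** Near 0 the weight is comparable to [x ^ (beta t) / x], and [x ^ (beta t)] is at
    least 1/2 down to the M-th dyadic scale: the mass near 0 grows like [M]. *)
Lemma beta_int_ge_near0 beta t (M : nat) : 0 < beta -> 0 < t -> t <= 2^-1 ->
  2^-1 <= (4^-1 / 2 ^+ M) `^ (beta * t) ->
  (((3 / 4) `^ beta * (M%:R / 4))%:E <= beta_int beta t (ioo 0 4^-1))%E.
Proof.
move=> b0 t0 t2; set d : R := 4^-1 / 2 ^+ M => dbt.
have d0 : 0 < d by rewrite divr_gt0 ?exprn_gt0.
have bt0 : 0 < beta * t by rewrite mulr_gt0.
have k0 : 0 <= (3 / 4) `^ beta * 2^-1 :> R by rewrite mulr_ge0 ?powR_ge0.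
apply: (@le_trans _ _ (beta_int beta t (ico d 4^-1))); last first.
  apply: ge0_subset_integral => //=.
  - by apply/measurable_EFinP; exact: measurable_beta_weight.
  - by move=> x _; rewrite lee_fin beta_weight_ge0.
  - by apply: subset_itvr; rewrite bnd_simp.
apply: (@le_trans _ _ (((3 / 4) `^ beta * 2^-1)%:E *
    \int[mu]_(x in ico d 4^-1) (x `^ (-1))%:E)%E).
  rewrite (_ : _ * _ = ((3 / 4) `^ beta * 2^-1) * (M%:R / 2)); last by lra.
  rewrite EFinM; apply: lee_wpmul2l; first by rewrite lee_fin.
  exact: integral_inv_dyadic.
have minv (S : set R) : measurable_fun S (fun x : R => (x `^ (-1))%:E).
  by apply/measurable_EFinP; apply: measurable_funTS; exact: measurable_powR.
rewrite -ge0_integralZl//; last 2 first.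
- exact: minv.
- by move=> x _; rewrite lee_fin powR_ge0.
apply: ge0_le_integral => //=.
- by move=> x _; rewrite -EFinM lee_fin mulr_ge0// powR_ge0.
- by apply: measurable_funeM; exact: minv.
- by apply/measurable_EFinP; exact: measurable_beta_weight.
move=> x; rewrite in_itv/= => /andP[]; move: x => x x1 x2.
rewrite -EFinM lee_fin /beta_weight -mulrA mulrC; apply: ler_pM.
- by rewrite mulr_ge0// powR_ge0.
- exact: powR_ge0.
- rewrite powRD; last by apply/implyP => _; rewrite gt_eqF//; lra.
  apply: ler_wpM2r; first exact: powR_ge0.
  by apply: le_trans dbt _; apply: ge0_ler_powR; rewrite ?nnegrE; lra.
apply: (@le_trans _ _ ((1 - x) `^ beta)).
  by apply: ge0_ler_powR; rewrite ?nnegrE; lra.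
by apply: ger_powR; rewrite ?mulrBr; lra.
Qed.

(** Since [exp u >= 1 + u], it suffices that [t], [beta t] and [- beta t ln d] are at
    most 1/2, which the denominator [D] ensures. *)
Lemma exists_small_exponent beta (d : R) : 0 < beta -> 0 < d <= 1 ->
  exists t, [/\ 0 < t, t <= 2^-1, beta * t <= 1 & 2^-1 <= d `^ (beta * t)].
Proof.
move=> b0 /andP[d0 d1]; have l0 : 0 <= - ln d by rewrite oppr_ge0 ln_le0.
pose D := 2 + beta * (2 - 2 * ln d).
have D0 : 0 < D.
  have : 0 <= beta * (2 - 2 * ln d) by apply: mulr_ge0; lra.
  by rewrite /D; lra.
pose t := D^-1.
have t0 : 0 < t by rewrite invr_gt0.
have tD : t * D = 1 by rewrite mulVf ?gt_eqF.
have tb0 : 0 < t * beta by rewrite mulr_gt0.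
have tbl : 0 <= t * beta * - ln d by rewrite mulr_ge0 // ltW.
have tE : t * 2 + t * beta * 2 + (t * beta * - ln d) * 2 = 1.
  by rewrite -[RHS]tD /D; lra.
exists t; split=> //; [by lra|by rewrite mulrC; lra|].
rewrite /powR gt_eqF//; apply: le_trans (expR_ge1Dx _).
by rewrite [beta * t]mulrC; lra.
Qed.

End beta_integral_bounds.

(** * Failure of displacement convexity *)

(** Condition [Q] on [g t < 1/4] and on [g t >= 1/2]. Along a geodesic between these
    two measures, the midpoint is carried by [g t >= 1/8], and the entropies of all
    three are controlled by the masses of these sets; the curvature term is bounded
    because the diameter is at most 1. *)
Lemma Ric_concentration (R : realType) (Q : Prob (G0 R)) (K t : R) :
  generalized_Ric_ge Q K -> 0 < t < 1 ->
  (0 < Q [set g | (G0_eval g t < 4^-1)%R])%E ->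
  (0 < Q [set g | (2^-1 <= G0_eval g t)%R])%E ->
  fine (Q [set g | G0_eval g t < 4^-1]) *
    fine (Q [set g | (2^-1 <= G0_eval g t)%R]) <=
  expR (`|K| / 4) * fine (Q [set g | (8^-1 <= G0_eval g t)%R]) ^+ 2.
Proof.
move=> Ric /andP[t0 t1]; have t01 : 0 <= t < 1 by rewrite ltW.
set A0 : set (borel (G0 R)) := [set g | G0_eval g t < 4^-1].
set A1 : set (borel (G0 R)) := [set g | 2^-1 <= G0_eval g t].
set A : set (borel (G0 R)) := [set g | 8^-1 <= G0_eval g t] => Q0 Q1.
have mA1 : measurable A1 by exact: measurable_G0_eval_ge.
have mA : measurable A by exact: measurable_G0_eval_ge.
have mA0 : measurable A0.
  rewrite (_ : A0 = ~` [set g | 4^-1 <= G0_eval g t]).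
    by apply: measurableC; exact: measurable_G0_eval_ge.
  by apply/seteqP; split => g /=; rewrite /A0/= ltNge => /negP.
have [mu0 [mu0Q mu0A EntE0]] := exists_conditioned mA0 Q0.
have [mu1 [mu1Q mu1A EntE1]] := exists_conditioned mA1 Q1.
have [mu_ [_ [mu_0 mu_1] _ speed] /(_ 2^-1)] := Ric mu0 mu1 mu0Q mu1Q.
set nu := mu_ 2^-1 => /(_ ltac:(lra)) Entmid.
set D := wasserstein mu0 mu1 in speed Entmid.
have W0 : wasserstein mu0 nu = 2^-1 * D.
  rewrite -{1}mu_0 speed ?lexx ?ler01//; last by lra.
  by rewrite sub0r normrN ger0_norm// invr_ge0.
have W1 : wasserstein nu mu1 = 2^-1 * D.
  rewrite -{1}mu_1 speed ?lexx ?ler01//; last by lra.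
  by congr (_ * _); rewrite ltr0_norm; lra.
(* If z is below 1/8 at a time s > t, it is so on all of [t, s[ by monotonicity,
   where (x + y) / 2 >= 1/4. *)
have null s : t < s -> s < 1 -> nu (~` [set g | 8^-1 <= G0_eval g s]) = 0%E.
  move=> ts s1; have s01 : 0 <= s < 1 by lra.
  apply: (midpoint_null G0_finely_partitioned (@G0_dist_le1 R) mA1 _
    (k := 16^-1 * (s - t)) _ mu1A _ W0 W1).
  - by apply: measurableC; exact: measurable_G0_eval_ge.
  - by rewrite mulr_gt0// subr_gt0.
  - move=> x y z yA /negP; rewrite -ltNge => zs.
    by apply: sqmdist_midpoint => //; exact: ltW.
(* Right continuity at t lets s decrease to t along a sequence. *)
have nuA : nu (~` A) = 0%E.
  pose s n : R := t + (1 - t) / n.+2%:R.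
  have s_gt n : t < s n by rewrite ltrDl divr_gt0// ?ltr0n// subr_gt0.
  have s_lt1 n : s n < 1.
    by rewrite /s -ltrBrDl ltr_pdivrMr ?ltr0n// ltr_pMr ?subr_gt0// ltr1n.
  apply: measure_negligible; first exact: measurableC.
  pose B n : set (borel (G0 R)) := ~` [set g | 8^-1 <= G0_eval g (s n)].
  suff : nu.-negligible (\bigcup_n B n).
    apply: negligibleS => g /= /negP; rewrite -ltNge => gt8.
    have [e /= e0 He] : \forall u \near t^'+, G0_eval g u < 8^-1.
      by apply: (cvgr_lt (G0_eval g t)) => //; exact: G0_eval_rc.
    exists (Num.truncn ((1 - t) / e)) => //=; apply/negP; rewrite -ltNge.
    apply: He => //=; rewrite ltr0_norm ?subr_lt0// opprB /s addrC addKr.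
    rewrite ltr_pdivrMr ?ltr0n// mulrC -ltr_pdivrMr//.
    by rewrite (lt_trans (truncnS_gt _))// ltr_nat.
  apply: negligible_bigcup => n; exists (B n).
  split=> //; last exact: null.
  apply: measurableC; apply: measurable_G0_eval_ge.
  by rewrite s_lt1 andbT (le_trans (ltW t0))// ltW.
have Wle1 : D ^+ 2 <= 1.
  exact: wasserstein_le1 G0_finely_partitioned (@G0_dist_le1 R) _ _.
have := le_trans (Ent_ge_supp Q mA nuA) Entmid.
rewrite EntE0 EntE1 -!EFinM -!EFinD lee_fin.
set q0 := fine (Q A0); set q1 := fine (Q A1); set q := fine (Q A).
move=> H.
have q0_gt0 : 0 < q0 by rewrite fine_gt0// Q0 ltey_eq fin_num_measure.
have q1_gt0 : 0 < q1 by rewrite fine_gt0// Q1 ltey_eq fin_num_measure.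
have q_gt0 : 0 < q.
  apply: lt_le_trans q1_gt0 _; apply: fine_le; rewrite ?fin_num_measure//.
  by apply: le_measure; rewrite ?inE// => g /= ; apply: le_trans; lra.
have KD : - (K * D ^+ 2) <= `|K|.
  apply: le_trans (ler_norm _) _; rewrite normrN normrM ler_piMr//.
  by rewrite ger0_norm ?sqr_ge0.
rewrite -ler_ln ?posrE ?mulr_gt0 ?expR_gt0 ?exprn_gt0//.
rewrite [leLHS]lnM ?posrE// [leRHS]lnM ?posrE ?expR_gt0 ?exprn_gt0// expRK lnXn//.
lra.
Qed.

Theorem theorem1p1 (R : realType) :
  ~ exists (K beta : R) (Q : Prob (G0 R)),
      [/\ 0 < beta, is_entropic_measure beta Q & generalized_Ric_ge Q K].
Proof.
move=> [K [beta [Q [b0 QE Ric]]]].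
pose I := beta_int beta; pose U : set R := `]0, 1[%classic.
have half01 : 0 < (2^-1 : R) < 1 by lra.
(* The marginal at time 1/2 makes the dominating Beta integral finite. *)
have [_ _ [Ifin _]] := entropic_marginal_pos QE half01.
(* F bounds the mass of [1/8, 1[ uniformly in t, and k M / 4 will bound from
   below the product of the masses of ]0, 1/4[ and [1/2, 1[. *)
pose F := 8 / 8^-1 `^ beta * fine (I 2^-1 U).
pose k : R := (3 / 4) `^ beta * (4^-1 `^ beta / 4).
have k0 : 0 < k by rewrite !mulr_gt0 ?powR_gt0 ?invr_gt0//; lra.
pose C := expR (`|K| / 4) * F ^+ 2.
pose M := (Num.truncn (4 * C / k)).+1.
have MC : C < M%:R / 4 * k.
  have : 4 * C / k < M%:R by exact: truncnS_gt.
  by rewrite ltr_pdivrMr//; lra.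
pose d : R := 4^-1 / 2 ^+ M.
have d01 : 0 < d <= 1.
  rewrite divr_gt0 ?exprn_gt0//= (@le_trans _ _ 4^-1)//; last by lra.
  by rewrite ler_piMr// invf_le1 ?exprn_gt0// exprn_ege1// ler1n.
have [t [t0 t2 bt1 dt]] := exists_small_exponent b0 d01.
have t01 : 0 < t < 1 by lra.
have [Z Z0 [Itfin QI]] := entropic_marginal_pos QE t01.
pose A0 : set R := `]-oo, 4^-1[%classic; pose A1 : set R := `[2^-1, +oo[%classic.
pose A : set R := `[8^-1, +oo[%classic.
have U0 : U `&` A0 = (`]0, 4^-1[%classic : set R).
  rewrite /U /A0 /A1 /A; apply/seteqP.
  by split => x /=; rewrite !in_itv/=; [case|split]; lra.
have U1 : U `&` A1 = (`[2^-1, 1[%classic : set R).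
  rewrite /U /A0 /A1 /A; apply/seteqP.
  by split => x /=; rewrite !in_itv/= ?andbT; [case|split]; lra.
have UA : U `&` A = (`[8^-1, 1[%classic : set R).
  rewrite /U /A0 /A1 /A; apply/seteqP.
  by split => x /=; rewrite !in_itv/= ?andbT; [case|split]; lra.
have Q0E : Q [set g | G0_eval g t < 4^-1] =
    (Z%:E * I t (`]0%R, 4^-1%R[%classic : set R))%E.
  by rewrite -U0 -(QI A0 (measurable_itv _)).
have Q1E : Q [set g | 2^-1 <= G0_eval g t] =
    (Z%:E * I t (`[2^-1%R, 1%R[%classic : set R))%E.
  rewrite -U1 -(QI A1 (measurable_itv _)); congr (Q _).
  by apply/seteqP; split => g; rewrite /A0 /A1 /A /= in_itv/= andbT.
have QAE : Q [set g | 8^-1 <= G0_eval g t] =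
    (Z%:E * I t (`[8^-1%R, 1%R[%classic : set R))%E.
  rewrite -UA -(QI A (measurable_itv _)); congr (Q _).
  by apply/seteqP; split => g; rewrite /A0 /A1 /A /= in_itv/= andbT.
have It_fin (S : set R) : measurable S -> S `<=` U -> I t S \is a fin_num.
  move=> mS SU; rewrite ge0_fin_numE ?beta_int_ge0//.
  apply: (@le_lt_trans _ _ (I t U)).
    apply: ge0_subset_integral => //; first exact: measurable_itv.
    - by apply/measurable_EFinP; exact: measurable_beta_weight.
    - by move=> x _; rewrite lee_fin beta_weight_ge0.
  by rewrite ltey_eq Itfin.
have := beta_int_ge_near0 b0 t0 t2 dt.
have := beta_int_ge_mid b0 t0 t2 bt1; have := beta_int_le_away0 b0 t0 t2 bt1.
have fin0 : I t (`]0, 4^-1[%classic : set R) \is a fin_num.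
  rewrite -U0; apply: It_fin; last exact: subIsetl.
  by apply: measurableI; exact: measurable_itv.
have fin1 : I t (`[2^-1, 1[%classic : set R) \is a fin_num.
  rewrite -U1; apply: It_fin; last exact: subIsetl.
  by apply: measurableI; exact: measurable_itv.
have finA : I t (`[8^-1, 1[%classic : set R) \is a fin_num.
  rewrite -UA; apply: It_fin; last exact: subIsetl.
  by apply: measurableI; exact: measurable_itv.
have := Ric_concentration Ric t01; rewrite Q0E Q1E QAE -/I.
rewrite -(fineK fin0) -(fineK fin1) -(fineK finA) -[I 2^-1 _](fineK Ifin) -!EFinM.
set a := fine (I t `]0, _[%classic); set b := fine (I t `[2^-1, _[%classic).
set m := fine (I t `[8^-1, _[%classic).
rewrite /= !lte_fin !lee_fin -/F => Qineq mF b_ge a_ge.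
have b_gt0 : 0 < b by apply: lt_le_trans b_ge; rewrite divr_gt0 ?powR_gt0 ?invr_gt0.
have a_gt0 : 0 < a.
  apply: lt_le_trans a_ge; apply: mulr_gt0; first by apply: powR_gt0; lra.
  by rewrite divr_gt0 ?ltr0n.
have m_ge0 : 0 <= m by rewrite fine_ge0// beta_int_ge0.
have {Qineq} := Qineq (mulr_gt0 Z0 a_gt0) (mulr_gt0 Z0 b_gt0).
have -> : Z * a * (Z * b) = Z ^+ 2 * (a * b) by rewrite mulrACA expr2.
have -> : expR (`|K| / 4) * (Z * m) ^+ 2 = Z ^+ 2 * (expR (`|K| / 4) * m ^+ 2).
  by rewrite exprMn mulrCA.
rewrite ler_pM2l ?exprn_gt0// leNgt => /negP; apply.
apply: (@le_lt_trans _ _ C).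
  by rewrite ler_wpM2l ?expR_ge0// ler_pXn2r// nnegrE (le_trans m_ge0).
apply: lt_le_trans MC _.
have -> : M%:R / 4 * k = (3 / 4) `^ beta * (M%:R / 4) * (4^-1 `^ beta / 4).
  by rewrite /k mulrCA mulrA.
by apply: ler_pM => //; rewrite ?mulr_ge0 ?powR_ge0 ?divr_ge0 ?invr_ge0.
Qed.
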